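(* Let $K$ be a perfect compact Hausdorff space. A closed linear subspace $Z\subset C(K)$ is poor if and only if for every open subset $U\subset K$, for every two probability measures $\pi_1,\pi_2$ on $U$ and for every $\varepsilon>0$ there is a probability measure $\nu$ on $U$ such that $\|\nu-\pi_1\|_{Z^*}<\varepsilon$ and $\|\pi_2-\nu\|>2-\varepsilon$.
   Context: All Banach spaces are real. A Banach space $X$ has the Daugavet property if $\|\mathrm{Id}+T\|=1+\|T\|$ for every rank-one bounded linear operator $T\colon X\to X$. If $X$ has the Daugavet property, a closed linear subspace $Z\subset X$ is poor if $X/\tilde Z$ has the Daugavet property for every closed linear subspace $\tilde Z\subset Z$. $C(K)$ (sup norm) is known to have the Daugavet property when $K$ is a perfect (i.e. without isolated points) compact Hausdorff space. All measures on $K$ are finite regular Borel measures; $M(K)=C(K)^*$ is the space of finite regular signed Borel measures with total variation norm $\|\cdot\|$. A probability measure on $U$ is a probability measure $\pi$ on $K$ with $\pi(U)=1$. For $\mu\in M(K)$, $\|\mu\|_{Z^*}=\sup\{|\int z\,d\mu|: z\in Z,\ \|z\|\le1\}$. *)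

(* Defs.v *)
From HB Require Import structures.
From mathcomp Require Import all_boot all_order all_algebra generic_quotient.
From mathcomp Require Import all_classical all_reals all_analysis.

Set Implicit Arguments.
Unset Strict Implicit.
Unset Printing Implicit Defensive.
Import Order.TTheory GRing.Theory Num.Theory.
Import numFieldNormedType.Exports.
Local Open Scope classical_set_scope.
Local Open Scope ring_scope.

Section ClosedSubspace.
Context (R : realType) (V : normedModType R).

Record closedSubspace := ClosedSubspace {
  csub :> set V;
  csub_submod : submod_closed (mem csub);
  csub_closed : closed csub }.

End ClosedSubspace.
Arguments closedSubspace {R} V.

(* The quotient of V by a closed subspace Z, with
   ||q|| = inf { ||v|| : v in the coset q }. *)
Section Quotient.
Context (R : realType) (V : normedModType R) (Z : closedSubspace V).
Local Open Scope quotient_scope.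

Let Z0 : csub Z 0.
Proof. by have [/set_mem] := csub_submod Z. Qed.

Let ZP a u v : csub Z u -> csub Z v -> csub Z (a *: u + v).
Proof.
have [_ h] := csub_submod Z => Zu Zv.
by apply/set_mem/h; apply/mem_set.
Qed.

Let ZD u v : csub Z u -> csub Z v -> csub Z (u + v).
Proof. by move=> Zu Zv; rewrite -[u]scale1r; exact: ZP. Qed.

Let ZZ a u : csub Z u -> csub Z (a *: u).
Proof. by move=> Zu; rewrite -[_ *: _]addr0; exact: ZP. Qed.

Let ZN u : csub Z u -> csub Z (- u).
Proof. by move=> Zu; rewrite -scaleN1r; exact: ZZ. Qed.

Definition coset_rel : rel V := fun u v => `[< csub Z (u - v) >].

Let coset_refl : reflexive coset_rel.
Proof. by move=> u; apply/asboolP; rewrite subrr. Qed.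

Let coset_sym : symmetric coset_rel.
Proof.
by move=> u v; apply/asboolP/asboolP => /ZN; rewrite opprB.
Qed.

Let coset_trans : transitive coset_rel.
Proof.
move=> v u w /asboolP uv /asboolP vw; apply/asboolP.
by rewrite -(subrK v u) -addrA; exact: ZD.
Qed.

Canonical coset_equiv := EquivRel coset_rel coset_refl coset_sym coset_trans.

Definition quotient : Type := {eq_quot coset_rel}.
HB.instance Definition _ := Choice.on quotient.
HB.instance Definition _ := EqQuotient.on quotient.

Definition qproj (v : V) : quotient := \pi_quotient v.

Lemma qprojP u v : qproj u = qproj v <-> csub Z (u - v).
Proof.
split=> [/eqP|uv]; first by rewrite eqmodE => /asboolP.
by apply/eqP; rewrite eqmodE; apply/asboolP.
Qed.

Lemma qproj_surj (q : quotient) : exists v, qproj v = q.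
Proof. by exists (repr q); exact: reprK. Qed.

Definition qzero : quotient := qproj 0.
Definition qopp (p : quotient) : quotient := qproj (- repr p).
Definition qadd (p q : quotient) : quotient := qproj (repr p + repr q).
Definition qscale (a : R) (p : quotient) : quotient := qproj (a *: repr p).
Definition qnorm (p : quotient) : R := inf [set `|v| | v in [set v | qproj v = p]].

Let qrepr v : csub Z (repr (qproj v) - v).
Proof. by apply/qprojP; exact: reprK. Qed.

Lemma qprojN v : qopp (qproj v) = qproj (- v).
Proof. by apply/qprojP; rewrite -opprD; exact: ZN. Qed.

Lemma qprojD u v : qadd (qproj u) (qproj v) = qproj (u + v).
Proof. by apply/qprojP; rewrite opprD addrACA; apply: ZD. Qed.

Lemma qprojZ a v : qscale a (qproj v) = qproj (a *: v).
Proof. by apply/qprojP; rewrite -scalerBr; apply: ZZ. Qed.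

Let qaddA : associative qadd.
Proof.
move=> p q r; have [u <-] := qproj_surj p; have [v <-] := qproj_surj q.
by have [w <-] := qproj_surj r; rewrite !qprojD addrA.
Qed.

Let qaddC : commutative qadd.
Proof.
move=> p q; have [u <-] := qproj_surj p; have [v <-] := qproj_surj q.
by rewrite !qprojD addrC.
Qed.

Let qadd0 : left_id qzero qadd.
Proof. by move=> p; have [u <-] := qproj_surj p; rewrite qprojD add0r. Qed.

Let qaddN : left_inverse qzero qopp qadd.
Proof.
by move=> p; have [u <-] := qproj_surj p; rewrite qprojN qprojD addNr.
Qed.

HB.instance Definition _ :=
  GRing.isZmodule.Build quotient qaddA qaddC qadd0 qaddN.

Let qscaleA a b p : qscale a (qscale b p) = qscale (a * b) p.
Proof. by have [u <-] := qproj_surj p; rewrite !qprojZ scalerA. Qed.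

Let qscale1 : left_id 1 qscale.
Proof. by move=> p; have [u <-] := qproj_surj p; rewrite qprojZ scale1r. Qed.

Let qscaleDr : right_distributive qscale +%R.
Proof.
move=> a p q; have [u <-] := qproj_surj p; have [v <-] := qproj_surj q.
by rewrite /GRing.add/= !(qprojZ, qprojD) scalerDr.
Qed.

Let qscaleDl p : {morph qscale^~ p : a b / a + b}.
Proof.
move=> a b; have [u <-] := qproj_surj p.
by rewrite [RHS]/GRing.add/= !(qprojZ, qprojD) scalerDl.
Qed.

HB.instance Definition _ := GRing.Zmodule_isLmodule.Build R quotient
  qscaleA qscale1 qscaleDr qscaleDl.

Let qnorm_lbound p :
  lbound [set `|v| | v in [set v : V | qproj v = p]] 0.
Proof. by move=> _ [v _ <-]. Qed.

Let qnorm_has_inf p : has_inf [set `|v| | v in [set v : V | qproj v = p]].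
Proof.
split; last by exists 0; exact: qnorm_lbound.
by have [v vp] := qproj_surj p; exists `|v|, v.
Qed.

Let qnorm_le v : qnorm (qproj v) <= `|v|.
Proof. by apply: ge_inf; [case: (qnorm_has_inf (qproj v))|exists v]. Qed.

Let qnorm_ge0 p : 0 <= qnorm p.
Proof. by apply: lb_le_inf; [case: (qnorm_has_inf p)|exact: qnorm_lbound]. Qed.

Let qnorm_adherent p e : 0 < e -> exists2 v, qproj v = p & `|v| < qnorm p + e.
Proof.
by move=> /inf_adherent/(_ (qnorm_has_inf p))[_ [v vp <-] ve]; exists v.
Qed.

Let qnormD p q : qnorm (p + q) <= qnorm p + qnorm q.
Proof.
apply/ler_addgt0Pr => e e0.
have e20 : 0 < e / 2 by rewrite divr_gt0.
have [u up ue] := qnorm_adherent p e20.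
have [v vq ve] := qnorm_adherent q e20.
have -> : p + q = qproj (u + v) by rewrite -qprojD up vq.
apply: (le_trans (qnorm_le _)); apply: (le_trans (ler_normD _ _)).
by rewrite [e]splitr addrACA; apply: lerD; exact: ltW.
Qed.

Let qnormZ_le a p : qnorm (a *: p) <= `|a| * qnorm p.
Proof.
have [->|a0] := eqVneq a 0.
  rewrite normr0 mul0r scale0r.
  by apply: (le_trans (qnorm_le 0)); rewrite normr0.
rewrite -ler_pdivrMl ?normr_gt0//.
apply: lb_le_inf; first by case: (qnorm_has_inf p).
move=> _ [v vp <-].
rewrite ler_pdivrMl ?normr_gt0// -normrZ.
have -> : a *: p = qproj (a *: v) by rewrite -qprojZ vp.
exact: qnorm_le.
Qed.

Let qnormZ (a : R) p : qnorm (a *: p) = `|a| * qnorm p.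
Proof.
apply/eqP; rewrite eq_le qnormZ_le/=.
have [->|a0] := eqVneq a 0; first by rewrite normr0 mul0r.
rewrite -ler_pdivlMl ?normr_gt0// -normfV.
by rewrite -{1}[p]scale1r -(mulVf a0) -scalerA.
Qed.

Let qnorm0_eq0 p : qnorm p = 0 -> p = 0.
Proof.
move=> p0; have [u up] := qproj_surj p; rewrite -up.
apply/qprojP; rewrite subr0.
apply: (csub_closed (c := Z)) => B /nbhs_ballP[e /= e0 eB].
have [v vp] := qnorm_adherent p e0; rewrite p0 add0r => ve.
exists (u - v); split; first by apply/qprojP; rewrite up vp.
by apply: eB; rewrite -ball_normE /ball_/= opprB addrC subrK.
Qed.

HB.instance Definition _ := @Lmodule_isNormed.Build R quotient
  qnorm qnormD qnormZ qnorm0_eq0.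

End Quotient.

Section Daugavet.
Context (R : realType).

Definition opnorm (X : normedModType R) (T : X -> X) : R :=
  sup [set `|T x| | x in [set x : X | `|x| <= 1]].

(* The rank is exactly one: the range is a line. *)
Definition rank_one (X : normedModType R) (T : X -> X) : Prop :=
  exists2 y : X, y != 0 & range T = [set a *: y | a in [set: R]].

Definition daugavet (X : normedModType R) : Prop :=
  forall T : {linear X -> X}, bounded_near T (nbhs (0 : X)) -> rank_one T ->
    opnorm (fun x => x + T x) = 1 + opnorm T.

Definition poor (X : normedModType R) (Z : closedSubspace X) : Prop :=
  forall Z' : closedSubspace X, Z' `<=` Z -> daugavet (quotient Z').

End Daugavet.

(* The space C(K). Compactness of K, which makes the sup norm finite, is a
   parameter of the type so that the normed module structure can be canonical. *)
Definition contfun (R : realType) (K : topologicalType)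
  of compact [set: K] : Type := continuousType K R.

Section ContFun.
Context (R : realType) (K : topologicalType) (cK : compact [set: K]).
Local Notation CK := (contfun R cK).

Definition contfun_fun (f : CK) : K -> R := (f : continuousType K R).
Coercion contfun_fun : contfun >-> Funclass.

HB.instance Definition _ := gen_eqMixin CK.
HB.instance Definition _ := gen_choiceMixin CK.

Lemma contfun_continuous (f : CK) : continuous (f : K -> R).
Proof. exact: (@cts_fun _ _ (f : continuousType K R)). Qed.

Lemma contfunP (f g : CK) : f = g <-> (f : K -> R) =1 g.
Proof. exact: (@continuousEP K R f g). Qed.

Definition mkcont (f : K -> R) (cf : continuous f) : CK :=
  (mkcts cf : continuousType K R).

Let cst_cont : continuous (fun _ : K => 0 : R).
Proof. by move=> x; exact: cvg_cst. Qed.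

Let opp_cont (f : CK) : continuous (fun x => - f x).
Proof. by move=> x; apply: cvgN; exact: contfun_continuous. Qed.

Let add_cont (f g : CK) : continuous (fun x => f x + g x).
Proof. by move=> x; apply: cvgD; exact: contfun_continuous. Qed.

Let scale_cont (a : R) (f : CK) : continuous (fun x => a * f x).
Proof. by move=> x; apply: cvgM; [exact: cvg_cst|exact: contfun_continuous]. Qed.

Definition contfun_zero : CK := mkcont cst_cont.
Definition contfun_opp (f : CK) : CK := mkcont (@opp_cont f).
Definition contfun_add (f g : CK) : CK := mkcont (@add_cont f g).
Definition contfun_scale (a : R) (f : CK) : CK := mkcont (@scale_cont a f).
Definition supnorm (f : CK) : R := sup [set `|f x| | x in [set: K]].

Let cfaddA : associative contfun_add.
Proof. by move=> f g h; apply/contfunP => x; exact: addrA. Qed.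

Let cfaddC : commutative contfun_add.
Proof. by move=> f g; apply/contfunP => x; exact: addrC. Qed.

Let cfadd0 : left_id contfun_zero contfun_add.
Proof. by move=> f; apply/contfunP => x; exact: add0r. Qed.

Let cfaddN : left_inverse contfun_zero contfun_opp contfun_add.
Proof. by move=> f; apply/contfunP => x; exact: addNr. Qed.

HB.instance Definition _ :=
  GRing.isZmodule.Build CK cfaddA cfaddC cfadd0 cfaddN.

Let cfscaleA a b f :
  contfun_scale a (contfun_scale b f) = contfun_scale (a * b) f.
Proof. by apply/contfunP => x; exact: mulrA. Qed.

Let cfscale1 : left_id 1 contfun_scale.
Proof. by move=> f; apply/contfunP => x; exact: mul1r. Qed.

Let cfscaleDr : right_distributive contfun_scale +%R.
Proof. by move=> a f g; apply/contfunP => x; exact: mulrDr. Qed.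

Let cfscaleDl f : {morph contfun_scale^~ f : a b / a + b}.
Proof. by move=> a b; apply/contfunP => x; exact: mulrDl. Qed.

HB.instance Definition _ := GRing.Zmodule_isLmodule.Build R CK
  cfscaleA cfscale1 cfscaleDr cfscaleDl.

Let supnorm_has_ub (f : CK) : has_ubound [set `|f x| | x in [set: K]].
Proof.
have : compact [set f x | x in [set: K]].
  apply: continuous_compact => //.
  exact/continuous_subspaceT/contfun_continuous.
move=> /compact_bounded[M [_ /(_ (M + 1))]]; rewrite ltrDl ltr01 => /(_ isT) fM.
by exists (M + 1) => _ [x _ <-]; apply: fM; exists x.
Qed.

Lemma le_supnorm (f : CK) x : `|f x| <= supnorm f.
Proof. by apply: ub_le_sup; [exact: supnorm_has_ub|exists x]. Qed.

Lemma supnorm_le (f : CK) (M : R) :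
  0 <= M -> (forall x, `|f x| <= M) -> supnorm f <= M.
Proof.
move=> M0 fM; rewrite /supnorm.
have [->|/set0P ne] := eqVneq [set `|f x| | x in [set: K]] set0.
  by rewrite sup0.
by apply: ge_sup => // _ [x _ <-].
Qed.

Let supnorm_ge0 (f : CK) : 0 <= supnorm f.
Proof.
rewrite /supnorm; have [->|/set0P[_ [x _ _]]] :=
  eqVneq [set `|f x| | x in [set: K]] set0; first by rewrite sup0.
exact: le_trans (le_supnorm f x).
Qed.

Let supnormD (f g : CK) : supnorm (f + g) <= supnorm f + supnorm g.
Proof.
apply: supnorm_le => [|x]; first exact: addr_ge0.
exact: le_trans (ler_normD _ _) (lerD (le_supnorm f x) (le_supnorm g x)).
Qed.

Let supnormZ_le (a : R) (f : CK) : supnorm (a *: f) <= `|a| * supnorm f.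
Proof.
apply: supnorm_le => [|x]; first exact: mulr_ge0.
by rewrite [X in `|X|]/(a * f x) normrM ler_wpM2l// le_supnorm.
Qed.

Let supnormZ (a : R) (f : CK) : supnorm (a *: f) = `|a| * supnorm f.
Proof.
apply/eqP; rewrite eq_le supnormZ_le/=.
have [->|a0] := eqVneq a 0; first by rewrite normr0 mul0r.
rewrite -ler_pdivlMl ?normr_gt0// -normfV.
by rewrite -{1}[f]scale1r -(mulVf a0) -scalerA.
Qed.

Let supnorm0_eq0 (f : CK) : supnorm f = 0 -> f = 0.
Proof.
move=> f0; apply/contfunP => x; apply/eqP; rewrite -normr_le0 -f0.
exact: le_supnorm.
Qed.

HB.instance Definition _ := @Lmodule_isNormed.Build R CK
  supnorm supnormD supnormZ supnorm0_eq0.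

End ContFun.

Notation borelType K := (g_sigma_algebraType (@open K)).

Section Measures.
Context (R : realType) (K : ptopologicalType).
Implicit Types (mu : {charge set (borelType K) -> \bar R}).

Definition regular_measure (mu : {measure set (borelType K) -> \bar R}) : Prop :=
  forall A : set (borelType K), measurable A ->
    mu A = ereal_inf [set mu O | O in [set O | @open K O /\ A `<=` O]] /\
    mu A = ereal_sup [set mu F | F in [set F | @compact K F /\ F `<=` A]].

Definition is_probability_on (U : set K) (pi : probability (borelType K) R) :=
  regular_measure pi /\ pi U = 1%E.

Definition charge_sub (mu nu : {finite_measure set (borelType K) -> \bar R}) :
    {charge set (borelType K) -> \bar R} :=
  cadd (charge_of_finite_measure mu) (copp (charge_of_finite_measure nu)).

Definition hahn_sets mu : {P : set _ * set _ | hahn_decomposition mu P.1 P.2}.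
Proof.
by apply: cid; have [P [N PN]] := Hahn_decomposition mu; exists (P, N).
Qed.

(* The total variation norm and the integral do not depend on the chosen Hahn
   decomposition, by uniqueness of the Jordan decomposition. *)
Definition tvnorm mu : R :=
  fine (charge_variation (proj2_sig (hahn_sets mu)) [set: K]).

Definition charge_integral mu (f : K -> R) : R :=
  \int[jordan_pos (proj2_sig (hahn_sets mu))]_x f x -
  \int[jordan_neg (proj2_sig (hahn_sets mu))]_x f x.

Definition dual_norm (cK : compact [set: K]) (Z : closedSubspace (contfun R cK))
    mu : R :=
  sup [set `|charge_integral mu z| | z in [set z | csub Z z /\ `|z| <= 1]].

End Measures.

(* Main.v *)
Require Import Defs.
From HB Require Import structures.
From mathcomp Require Import all_boot all_order all_algebra.
From mathcomp Require Import all_classical all_reals all_analysis.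
From mathcomp Require Import measurable_realfun ring lra.
Import Order.TTheory GRing.Theory Num.Theory.
Import numFieldNormedType.Exports.
Local Open Scope classical_set_scope.
Local Open Scope ring_scope.

(** The dual of C(K)/Z' is the annihilator of Z', so the Daugavet property of
    the quotients by subspaces of Z is a statement about functionals on C(K)
    that vanish on large parts of Z.

    Poor implies approximation. Let lam and phi be the integrals against pi1
    and pi2, and let e = w - phi be a functional that vanishes on
    Z' = Z /\ ker lam and almost attains its norm. The quotient by Z' has the
    Daugavet property; for the rank-one operator given by e and the class of
    f + t z it produces (daugavet_slice) a functional y of norm at most 1 that
    vanishes on Z', is almost maximal at f + t z, and is opposite to phi: some
    u in the unit ball has y u close to 1 and phi u close to -1. When
    0 <= f <= 1 is supported in U, lam f is close to 1 and t is small, y is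
    almost a probability measure carried by U and almost singular to pi2. On Z
    it is a multiple a lam, and y z >= lam z up to a small error. Doing this for
    z and -z with lam z = 1 and mixing the two functionals makes a close to 1
    (near_state_exists). The annihilation condition on e forces two rounds
    (poor_near_state). In the first, lam = phi and w = 0, which gives y1 almost
    singular to pi2 with y1 = a phi on Z. In the second, w = y1 / a, so that
    w - phi vanishes on all of Z and lam may be the integral against pi1. The
    representing measure of the positive part of the result, restricted to U
    and normalised, is nu.

    Approximation implies poor. The hypothesis passes to subspaces of Z, so it
    is enough to treat the quotient by Z. Let T send the class of v to e v times
    the class of f, where that class has norm 1, and let y of norm 1 vanish
    on Z with y f = 1. Write y = L1 - L2 with L1, L2 positive; L1 is concentrated
    where f is close to 1 and L2 where f is close to -1 (concentration). On
    these two disjoint open sets the hypothesis replaces L1 and L2 by measures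
    n1 and n2 that are close to them on Z and almost singular to a positive
    measure dominating e (singular_bump, concentrated_pair). Hence one function
    u can almost norm e and n1 - n2 simultaneously (daugavet_estimate), and
    since n1 - n2 almost annihilates Z it bounds the quotient norm of
    u + e u f from below by almost 1 + c, where c is the norm of e
    (quotient_norm_test).

    Two classical theorems are proved on the way: Hahn-Banach, as the linearity
    of minimal sublinear functionals, and the Riesz representation of positive
    functionals on C(K). *)

Set Implicit Arguments.
Unset Strict Implicit.
Unset Printing Implicit Defensive.

(** * The Hahn-Banach theorem *)

Section HahnBanach.
Context (R : realType) (V : lmodType R).
Implicit Types (q : V -> R) (x y : V).

(** Homogeneity is only required as an inequality: the reverse one follows by
    scaling back. *)
Definition sublinear q :=
  (forall x y, q (x + y) <= q x + q y) /\
  (forall t x, 0 < t -> q (t *: x) <= t * q x).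

Lemma sublinear0 q : sublinear q -> q 0 = 0.
Proof.
move=> [qD qZ]; apply/eqP; rewrite eq_le.
have h1 := qZ 2 0 (ltr0Sn _ _); have h2 := qZ 2^-1 0.
rewrite scaler0 in h1; rewrite scaler0 invr_gt0 ltr0Sn in h2.
have {}h2 := h2 isT; have := qD 0 0; rewrite addr0; lra.
Qed.

(** A convex cone D in V * R with fibres bounded below has a sublinear lower
    envelope. The fibre over 0 controls all the others, since D x r and D (- x) s
    give D 0 (r + s). Every extension problem below is encoded by such a cone. *)
Lemma sublinear_inf (D : V -> R -> Prop) :
  (forall x y r s, D x r -> D y s -> D (x + y) (r + s)) ->
  (forall t x r, 0 < t -> D x r -> D (t *: x) (t * r)) ->
  (forall x, exists r, D x r) -> (forall r, D 0 r -> 0 <= r) ->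
  exists2 q, sublinear q & forall x r, D x r -> q x <= r.
Proof.
move=> DD DZ Dex D0; pose q x := inf [set r | D x r].
have hi x : has_inf [set r | D x r].
  split; first by have [r] := Dex x; exists r.
  have [s Ds] := Dex (- x); exists (- s) => r /= Dr.
  by have := DD _ _ _ _ Dr Ds; rewrite subrr => /D0; lra.
have qle x r : D x r -> q x <= r by move=> ?; apply: ge_inf => //; case: (hi x).
exists q => //; split => [x y|t x t0].
  apply/ler_addgt0Pr => e e0; have e2 : 0 < e / 2 by rewrite divr_gt0.
  have [r /= Dr re] := inf_adherent e2 (hi x).
  have [s /= Ds se] := inf_adherent e2 (hi y).
  by apply: (le_trans (qle _ _ (DD _ _ _ _ Dr Ds))); rewrite /q; lra.
rewrite -ler_pdivrMl//; apply: lb_le_inf; first by case: (hi x).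
by move=> r /= /(DZ t _ _ t0)/qle; rewrite ler_pdivrMl.
Qed.

(** Zorn: the pointwise infimum of a chain of sublinear functionals is again
    sublinear, the chain condition being what makes the infimum subadditive. *)
Lemma sublinear_minimal p : sublinear p ->
  exists q, [/\ sublinear q, forall x, q x <= p x &
    forall q', sublinear q' -> (forall x, q' x <= q x) -> q' = q].
Proof.
move=> sp.
pose T := {q | sublinear q /\ forall x, q x <= p x}.
pose le (a b : T) := `[< forall x, sval b x <= sval a x >].
have [||||m mP] := @Zorn T le.
- by move=> t; apply/asboolP.
- by move=> r s t /asboolP rs /asboolP st; apply/asboolP => x; apply: le_trans (rs x).
- move=> [s sP] [t tP] /asboolP st /asboolP ts; apply: eq_exist => /=.
  by apply/funext => x; apply/eqP; rewrite eq_le st ts.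
- move=> A Atot.
  have [->|/set0P[a0 Aa0]] := eqVneq A set0.
    by exists (exist _ p (conj sp (fun=> lexx _))).
  pose D x r := exists2 a, A a & sval a x <= r.
  have [|||r [a _]|q sq qD] := @sublinear_inf D.
  + move=> x y r s [a Aa ar] [b Ab bs].
    have [/asboolP ab|/asboolP ba] := Atot a b Aa Ab.
      exists b => //; apply: (le_trans ((svalP b).1.1 x y)).
      by apply: lerD => //; apply: le_trans ar.
    exists a => //; apply: (le_trans ((svalP a).1.1 x y)).
    by apply: lerD => //; apply: le_trans bs.
  + move=> t x r t0 [a Aa ar]; exists a => //.
    by apply: (le_trans ((svalP a).1.2 t x t0)); rewrite ler_pM2l.
  + by move=> x; exists (sval a0 x), a0.
  + by rewrite (sublinear0 (svalP a).1).
  have qp x : q x <= p x.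
    by apply: (le_trans (qD _ (sval a0 x) _)); [exists a0|case: (svalP a0)].
  exists (exist _ q (conj sq qp)) => s As; apply/asboolP => x /=.
  by apply: qD; exists s.
exists (sval m); split; [exact: (svalP m).1|exact: (svalP m).2|].
move=> q' sq' q'm.
have q'p x : q' x <= p x by apply: (le_trans (q'm x)); case: (svalP m).
have := mP (exist _ q' (conj sq' q'p)).
by move=> <- //; apply/asboolP.
Qed.

(** A minimal sublinear q is additive: the envelope
    x |-> inf_t (q (x + t y) - t q y) over t >= 0 is sublinear and below q, hence
    equal to q, and t = 1 then gives q x + q y <= q (x + y). *)
Lemma sublinear_dominates_linear p : sublinear p ->
  exists f : {scalar V}, forall x, f x <= p x.
Proof.
move=> /sublinear_minimal[q [sq qp qmin]].
have qge x y : q x + q y <= q (x + y).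
  pose D z r := exists2 t, 0 <= t & q (z + t *: y) - t * q y <= r.
  have [|||r [t t0]|q' sq' q'D] := @sublinear_inf D.
  - move=> u v r s [t t0 tr] [t' t0' tr']; exists (t + t'); first exact: addr_ge0.
    have := sq.1 (u + t *: y) (v + t' *: y).
    by rewrite addrACA -scalerDl; lra.
  - move=> a u r a0 [t t0 tr]; exists (a * t); first by rewrite mulr_ge0// ltW.
    have := sq.2 a (u + t *: y) a0; rewrite scalerDr scalerA.
    have : a * (q (u + t *: y) - t * q y) <= a * r by rewrite ler_pM2l.
    lra.
  - by move=> u; exists (q (u + 1 *: y) - 1 * q y), 1.
  - rewrite add0r; move: t0; rewrite le_eqVlt => /predU1P[<-|t0].
      by rewrite scale0r mul0r (sublinear0 sq); lra.
    have := sq.2 t^-1 (t *: y); rewrite invr_gt0 => /(_ t0).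
    by rewrite scalerA mulVf ?gt_eqF// scale1r ler_pdivlMl//; lra.
  have q'q u : q' u <= q u.
    by apply: q'D; exists 0 => //; rewrite scale0r mul0r addr0 subr0.
  have e := qmin q' sq' q'q.
  have : q' x <= q (x + 1 *: y) - 1 * q y by apply: q'D; exists 1.
  by rewrite e scale1r mul1r; lra.
have qD x y : q (x + y) = q x + q y.
  by apply/eqP; rewrite eq_le qge sq.1.
have qN x : q (- x) = - q x.
  by have := qD x (- x); rewrite subrr (sublinear0 sq); lra.
have qZp a x : 0 < a -> q (a *: x) = a * q x.
  move=> a0; apply/eqP; rewrite eq_le sq.2//=.
  have := sq.2 a^-1 (a *: x); rewrite invr_gt0 => /(_ a0).
  by rewrite scalerA mulVf ?gt_eqF// scale1r ler_pdivlMl.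
have qZ a x : q (a *: x) = a * q x.
  have [a0|a0|->] := ltgtP a 0; last by rewrite scale0r mul0r sublinear0.
    rewrite -[a]opprK scaleNr qN qZp ?oppr_gt0//; lra.
  exact: qZp.
have qlin : linear_for *%R q by move=> a x y; rewrite qD qZ.
pose F := GRing.isLinear.Build R V R^o *:%R q qlin.
pose f : {scalar V} := HB.pack q F.
by exists f.
Qed.

(** Hahn-Banach in the form used throughout: any family of upper bounds
    f x <= r that is stable under positive combinations and consistent at 0 is
    satisfied by some linear f. *)
Lemma linear_below_cone (D : V -> R -> Prop) :
  (forall x y r s, D x r -> D y s -> D (x + y) (r + s)) ->
  (forall t x r, 0 < t -> D x r -> D (t *: x) (t * r)) ->
  (forall x, exists r, D x r) -> (forall r, D 0 r -> 0 <= r) ->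
  exists f : {scalar V}, forall x r, D x r -> f x <= r.
Proof.
move=> DD DZ Dex D0.
have [q /sublinear_dominates_linear[f fq] qD] := sublinear_inf DD DZ Dex D0.
by exists f => x r /qD; exact: le_trans.
Qed.

End HahnBanach.

(** * Norming functionals and quotients *)

Section Norming.
Context (R : realType).

Lemma scalarZ (V : lmodType R) (f : {scalar V}) a x : f (a *: x) = a * f x.
Proof. exact: linearZ. Qed.

Lemma scalar_combination (V : lmodType R) (a b : R) (f g : {scalar V}) :
  exists h : {scalar V}, forall x, h x = a * f x + b * g x.
Proof.
pose h : V -> R^o := fun x => a * f x + b * g x.
have hlin : linear_for *%R h.
  by move=> c x y; rewrite /h (linearP f) (linearP g)/=; ring.
pose H : {scalar V} := HB.pack h (GRing.isLinear.Build R V R^o *%R h hlin).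
by exists H.
Qed.

(** The bounds f x <= `|x + t x0| - t `|x0| contain f <= `|.| (t = 0) and
    f (- x0) <= - `|x0| (t = 1). *)
Lemma norming_functional (V : normedModType R) (x0 : V) :
  exists f : {scalar V}, (forall x, `|f x| <= `|x|) /\ f x0 = `|x0|.
Proof.
pose D (x : V) (r : R) := exists2 t, 0 <= t & `|x + t *: x0| - t * `|x0| <= r.
have [|||r [t t0]|f fD] := @linear_below_cone R V D.
- move=> x y r s [t t0 tr] [t' t0' tr']; exists (t + t'); first exact: addr_ge0.
  have := ler_normD (x + t *: x0) (y + t' *: x0).
  by rewrite addrACA -scalerDl; lra.
- move=> a x r a0 [t t0 tr]; exists (a * t); first by rewrite mulr_ge0// ltW.
  rewrite -scalerA -scalerDr normrZ gtr0_norm// -mulrA -mulrBr.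
  by rewrite ler_wpM2l// ltW.
- by move=> x; exists (`|x + 0 *: x0| - 0 * `|x0|), 0.
- by rewrite add0r normrZ ger0_norm// subrr.
have fle x : f x <= `|x|.
  by apply: fD; exists 0 => //; rewrite scale0r mul0r addr0 subr0.
exists f; split=> [x|].
  by rewrite ler_norml fle andbT lerNl -linearN -[leRHS]normrN; exact: fle.
apply/eqP; rewrite eq_le fle/= -lerN2 -linearN.
by apply: fD; exists 1 => //; rewrite scale1r mul1r addNr normr0 sub0r.
Qed.

Section quotient_norm.
Context (V : normedModType R) (Z : closedSubspace V).

Lemma csub0 : csub Z 0.
Proof. by have [/set_mem] := csub_submod Z. Qed.

Lemma csubZD (a : R) u v : csub Z u -> csub Z v -> csub Z (a *: u + v).
Proof.
have [_ h] := csub_submod Z => Zu Zv.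
by apply/set_mem/h; apply/mem_set.
Qed.

Lemma csubZ (a : R) u : csub Z u -> csub Z (a *: u).
Proof. by move=> Zu; rewrite -[_ *: _]addr0; apply: csubZD => //; exact: csub0. Qed.

Lemma csubN u : csub Z u -> csub Z (- u).
Proof. by move=> Zu; rewrite -scaleN1r; exact: csubZ. Qed.

Lemma qproj_add u v : qproj Z u + qproj Z v = qproj Z (u + v).
Proof. exact: qprojD. Qed.

Lemma qproj_scale (a : R) u : a *: qproj Z u = qproj Z (a *: u).
Proof. exact: qprojZ. Qed.

Lemma qproj_eq0 z : csub Z z -> qproj Z z = 0.
Proof. by move=> Zz; apply/qprojP; rewrite subr0. Qed.

Lemma norm_qproj u : `|qproj Z u| <= `|u|.
Proof.
by apply: ge_inf; [exists 0 => _ [v _ <-]|exists u].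
Qed.

Lemma norm_qproj_adherent (q : quotient Z) (e : R) : 0 < e ->
  exists2 v, qproj Z v = q & `|v| < `|q| + e.
Proof.
have hi : has_inf [set `|v| | v in [set v | qproj Z v = q]].
  by split; [have [v vq] := qproj_surj q; exists `|v|, v|exists 0 => _ [v _ <-]].
by move=> /inf_adherent/(_ hi)[_ [v vp <-] ve]; exists v.
Qed.

(** A functional that annihilates Z is constant on cosets, so its norm may be
    computed with the shortest representatives. *)
Lemma le_norm_qproj (y : {scalar V}) (c : R) u : 0 <= c ->
  (forall v, `|y v| <= c * `|v|) -> (forall z, csub Z z -> y z = 0) ->
  `|y u| <= c * `|qproj Z u|.
Proof.
move=> c0 yc yZ; apply/ler_addgt0Pr => e e0.
have ce : 0 < e / (c + 1) by rewrite divr_gt0// ltr_wpDl.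
have [v vu ve] := norm_qproj_adherent (qproj Z u) ce.
have -> : y u = y v.
  have /qprojP/yZ : qproj Z u = qproj Z v by [].
  by rewrite linearB/= => /subr0_eq.
apply: (le_trans (yc v)); apply: (le_trans (ler_wpM2l c0 (ltW ve))).
rewrite mulrDr lerD2l mulrA ler_pdivrMr ?ltr_wpDl// mulrC ler_wpM2l ?ltW//.
by rewrite ltrDl.
Qed.

(** The norming functional of the class of x0, read on V. *)
Lemma norming_annihilator (x0 : V) : exists f : {scalar V},
  [/\ forall x, `|f x| <= `|x|, forall z, csub Z z -> f z = 0 &
      f x0 = `|qproj Z x0|].
Proof.
have [f [fle fx0]] := norming_functional (qproj Z x0).
pose g : V -> R^o := fun x => f (qproj Z x).
have glin : linear_for *%R g.
  by move=> a x y; rewrite /g -qproj_add -qproj_scale linearP.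
pose G : {scalar V} := HB.pack g (GRing.isLinear.Build R V R^o *%R g glin).
exists G; split => //.
  by move=> x; apply: (le_trans (fle _)); exact: norm_qproj.
by move=> z Zz; rewrite /G/= /g qproj_eq0// linear0.
Qed.

End quotient_norm.
End Norming.

(** * Functionals on C(K) *)

Section ContinuousFunctions.
Context (R : realType) (K : topologicalType) (cK : compact [set: K]).
Local Notation CK := (contfun R cK).
Implicit Types (f g h : CK) (L : {scalar CK}).

Lemma contfunD f g x : (f + g : CK) x = f x + g x. Proof. by []. Qed.
Lemma contfunN f x : (- f : CK) x = - f x. Proof. by []. Qed.
Lemma contfunB f g x : (f - g : CK) x = f x - g x. Proof. by []. Qed.
Lemma contfunZ (a : R) f x : (a *: f : CK) x = a * f x. Proof. by []. Qed.
Lemma contfun0 x : (0 : CK) x = 0. Proof. by []. Qed.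

Definition contfun_cst (c : R) : CK := mkcont cK (fun x => @cvg_cst _ c _ _ _).

Lemma contfun_cst_val c x : contfun_cst c x = c. Proof. by []. Qed.

Lemma mul_cont f g : continuous (fun x => f x * g x).
Proof. by move=> x; apply: cvgM; exact: contfun_continuous. Qed.
Definition contfun_mul f g : CK := mkcont cK (@mul_cont f g).

Lemma contfun_mul_val f g x : contfun_mul f g x = f x * g x.
Proof. by []. Qed.

Lemma max_cont f g : continuous (fun x => Num.max (f x) (g x)).
Proof. by move=> x; apply: continuous_max; exact: contfun_continuous. Qed.
Definition contfun_max f g : CK := mkcont cK (@max_cont f g).

Lemma contfun_max_val f g x : contfun_max f g x = Num.max (f x) (g x).
Proof. by []. Qed.

Lemma min_cont f g : continuous (fun x => Num.min (f x) (g x)).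
Proof. by move=> x; apply: continuous_min; exact: contfun_continuous. Qed.
Definition contfun_min f g : CK := mkcont cK (@min_cont f g).

Lemma le_contfun_norm f x : `|f x| <= `|f|. Proof. exact: le_supnorm. Qed.
Lemma contfun_norm_le f (M : R) :
  0 <= M -> (forall x, `|f x| <= M) -> `|f| <= M.
Proof. exact: supnorm_le. Qed.

Definition positive L := forall f, (forall x, 0 <= f x) -> 0 <= L f.

Lemma positive_le L f g : positive L -> (forall x, f x <= g x) -> L f <= L g.
Proof.
move=> L0 fg; rewrite -subr_ge0 -linearB; apply: L0 => x.
by rewrite contfunB subr_ge0.
Qed.

Lemma contfun_cstE c : contfun_cst c = c *: contfun_cst 1.
Proof. by apply/contfunP => x; rewrite contfunZ !contfun_cst_val mulr1. Qed.

Lemma functional_cst L c : L (contfun_cst c) = c * L (contfun_cst 1).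
Proof. by rewrite contfun_cstE linearZ. Qed.

Lemma positive_norm L f : positive L -> `|L f| <= L (contfun_cst 1) * `|f|.
Proof.
move=> L0; rewrite mulrC -functional_cst ler_norml -linearN.
apply/andP; split; apply: positive_le => // x.
  by have := le_contfun_norm f x; rewrite ler_norml => /andP[].
by have := le_contfun_norm f x; rewrite ler_norml => /andP[].
Qed.

(** The bounds put on L1 f are c m + e g, where g <= m and f - g <= m pointwise.
    With m = 0 and g = 0 they make L1 positive; with m = 0 and g = f they make
    L1 - e positive; with the constants m = g = 1/2 they give
    2 L1 1 - e 1 <= c, which is the bound on the total mass. *)
Lemma jordan_functional (e : {scalar CK}) (c : R) : 0 <= c ->
  (forall f, e f <= c * `|f|) ->
  exists L1 L2 : {scalar CK}, [/\ positive L1, positive L2,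
    L1 (contfun_cst 1) + L2 (contfun_cst 1) <= c & forall f, e f = L1 f - L2 f].
Proof.
move=> c0 ec.
pose D f (r : R) := exists m g, [/\ 0 <= m, forall x, g x <= m,
  forall x, f x - g x <= m & c * m + e g <= r].
have [|||r [m [g [m0 gm gm']]]|L1 L1D] := @linear_below_cone R CK D.
- move=> f f' r r' [m [g [m0 gm fm mr]]] [m' [g' [m0' gm' fm' mr']]].
  exists (m + m'), (g + g'); split.
  + exact: addr_ge0.
  + by move=> x; rewrite contfunD lerD.
  + by move=> x; rewrite !contfunD; have := fm x; have := fm' x; lra.
  + by rewrite linearD/=; lra.
- move=> t f r t0 [m [g [m0 gm fm mr]]].
  exists (t * m), (t *: g); split.
  + by rewrite mulr_ge0// ltW.
  + by move=> x; rewrite contfunZ ler_pM2l.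
  + by move=> x; rewrite !contfunZ -mulrBr ler_pM2l.
  + by rewrite linearZ/= mulrCA -mulrDr ler_pM2l.
- move=> f; exists (c * `|f| + e 0), `|f|, 0; split => //.
  + by move=> x; rewrite contfun0.
  + by move=> x; rewrite contfun0 subr0 (le_trans (ler_norm _))// le_contfun_norm.
- apply: le_trans; have := ec (- g); rewrite linearN/=.
  have : `|- g| <= m.
    apply: contfun_norm_le => // x; rewrite ler_norml contfunN.
    by have := gm x; have := gm' x; rewrite contfun0; lra.
  by move=> /(ler_wpM2l c0); lra.
have [L2 L2E] := scalar_combination 1 (- 1) L1 e.
have L1D' f r : D (- f) r -> - r <= L1 f.
  by move=> /L1D; rewrite linearN/=; lra.
exists L1, L2; split.
- move=> f f0; rewrite -oppr0; apply: L1D'; exists 0, 0; split => //.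
    by move=> x; rewrite contfunN contfun0 subr0 oppr_le0.
  by rewrite mulr0 add0r linear0.
- move=> f f0; rewrite L2E mul1r mulN1r subr_ge0 -[leLHS]opprK; apply: L1D'.
  exists 0, (- f); split => //; rewrite ?mulr0 ?add0r ?linearN//.
    by move=> x; rewrite contfunN oppr_le0.
  by move=> x; rewrite subrr.
- have : L1 (contfun_cst 1) <= c * 2^-1 + e (contfun_cst 2^-1).
    apply: L1D; exists 2^-1, (contfun_cst 2^-1); split => //.
    by move=> x; rewrite !contfun_cst_val; lra.
  by rewrite (functional_cst e 2^-1) L2E; lra.
by move=> f; rewrite L2E; lra.
Qed.

Lemma urysohn_contfun (hK : hausdorff_space K) (A O : set K) :
  closed A -> open O -> A `<=` O ->
  exists f, [/\ forall x, 0 <= f x <= 1, forall x, A x -> f x = 1 &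
    forall x, ~ O x -> f x = 0].
Proof.
move=> cA oO AO.
have cO : closed (~` O) by exact: open_closedC.
have OA0 : ~` O `&` A = set0 by apply/disjoints_subset; exact: subsetC.
have [f [cf f0 f1 fr]] :=
  urysohn_ext_itv (compact_normal hK cK) cO cA OA0 (@ltr01 R).
exists (mkcont cK cf); split => x.
- by have := fr (f x); rewrite /= in_itv/=; apply; exists x.
- by move=> Ax; apply: f1; exists x.
- by move=> Ox; apply: f0; exists x.
Qed.

End ContinuousFunctions.

(** * The outer measure of a positive functional *)

Section RieszContent.
Context (R : realType) (K : ptopologicalType) (cK : compact [set: K]).
Context (hK : hausdorff_space K).
Local Notation CK := (contfun R cK).
Context (L : {scalar CK}) (L_ge0 : positive L).

(** The continuous functions between 0 and the indicator of O. Vanishing outside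
    O is required rather than having support in O; below_truncate recovers
    closed supports at a small cost. *)
Definition below (O : set K) (f : CK) :=
  (forall x, 0 <= f x <= 1) /\ (forall x, ~ O x -> f x = 0).

Definition content (O : set K) : R := sup [set L f | f in below O].

Lemma below0 O : below O 0.
Proof. by split=> x //; rewrite contfun0 lexx ler01. Qed.

Lemma below_le O O' f : O `<=` O' -> below O f -> below O' f.
Proof. by move=> OO' [f01 fO]; split=> // x nO'; apply: fO => /OO'. Qed.

Lemma below_has_sup O : has_sup [set L f | f in below O].
Proof.
split; first by exists (L 0), 0 => //; exact: below0.
exists (L (contfun_cst cK 1)) => _ [f [f01 _] <-]; apply: positive_le => // x.
by rewrite contfun_cst_val; case/andP: (f01 x).
Qed.

Lemma le_content O f : below O f -> L f <= content O.
Proof. by move=> fO; apply: ub_le_sup; [case: (below_has_sup O)|exists f]. Qed.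

Lemma content_le O c : (forall f, below O f -> L f <= c) -> content O <= c.
Proof.
by move=> h; apply: ge_sup; [case: (below_has_sup O)|move=> _ [f /h ? <-]].
Qed.

Lemma content_ge0 O : 0 <= content O.
Proof. by rewrite -(linear0 L); apply: le_content; exact: below0. Qed.

Lemma content_mono O O' : O `<=` O' -> content O <= content O'.
Proof.
by move=> OO'; apply: content_le => f fO; apply: le_content; exact: below_le fO.
Qed.

Lemma contentT : content [set: K] = L (contfun_cst cK 1).
Proof.
apply/eqP; rewrite eq_le; apply/andP; split.
  apply: content_le => f [f01 _]; apply: positive_le => // x.
  by rewrite contfun_cst_val; case/andP: (f01 x).
apply: le_content; split=> x; rewrite contfun_cst_val; first by rewrite ler01 lexx.
by move=> /(_ I).
Qed.

Lemma content_set0 : content set0 = 0.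
Proof.
apply/eqP; rewrite eq_le content_ge0 andbT; apply: content_le => f [_ f0].
have -> : f = 0 by apply/contfunP => x; rewrite f0.
by rewrite linear0.
Qed.

(** Replace f by the positive part of f - d for a small constant d: it vanishes
    off the closed set where f >= d, which lies inside O. *)
Lemma below_truncate O f (e : R) : below O f -> 0 < e ->
  exists g S, [/\ below S g, closed S, S `<=` O & L f <= L g + e].
Proof.
move=> [f01 fO] e0; pose c := L (contfun_cst cK 1).
have c0 : 0 <= c by apply: L_ge0 => x; rewrite contfun_cst_val ler01.
pose d := e / (c + 1).
have d0 : 0 < d by rewrite divr_gt0// ltr_wpDl.
pose g := contfun_max (f - contfun_cst cK d) 0.
exists g, (f @^-1` [set r | d <= r]); split.
- split=> x.
    rewrite contfun_max_val contfunB contfun_cst_val contfun0.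
    rewrite le_max lexx orbT ge_max ler01 andbT.
    by have /andP[] := f01 x; lra.
  move=> fd; rewrite contfun_max_val contfunB contfun_cst_val contfun0.
  by apply/max_idPr; rewrite subr_le0; apply/ltW; rewrite ltNge; apply/negP.
- apply: preimage_closed; last exact: closed_ge.
  by move=> x _; exact: contfun_continuous.
- by move=> x /= dx; apply: contrapT => /fO fx0; move: dx; rewrite fx0 leNgt d0.
- rewrite -lerBlDl -linearB.
  have : L (f - g) <= L (contfun_cst cK d).
    apply: positive_le => // x; rewrite contfunB contfun_cst_val.
    rewrite contfun_max_val contfunB contfun_cst_val contfun0.
    by rewrite lerBlDr -lerBlDl le_max lexx.
  move=> /le_trans; apply; rewrite functional_cst -/c /d mulrAC ler_pdivrMr ?ltr_wpDl//.
  by rewrite ler_wpM2l ?ltW// ltrDl.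
Qed.

(** If g vanishes off a closed S inside the union, a Urysohn function that is 1 on
    S \ O2 and 0 off O1 splits g into a part below O1 and a part below O2. *)
Lemma contentU O1 O2 : open O1 -> open O2 ->
  content (O1 `|` O2) <= content O1 + content O2.
Proof.
move=> oO1 oO2; apply: content_le => f fO; apply/ler_addgt0Pr => e e0.
have [g [S [gS cS SO]]] := below_truncate fO e0.
move=> /le_trans; apply; rewrite lerD2r.
have cSO : closed (S `&` ~` O2) by apply: closedI => //; exact: open_closedC.
have SO1 : S `&` ~` O2 `<=` O1 by move=> x [/SO[]].
have [h [h01 h1 h0]] := urysohn_contfun R cK hK cSO oO1 SO1.
have -> : g = contfun_mul g h + contfun_mul g (contfun_cst cK 1 - h).
  apply/contfunP => x; rewrite contfunD !contfun_mul_val contfunB contfun_cst_val.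
  by rewrite -mulrDr addrC subrK mulr1.
case: gS => g01 gS; rewrite linearD; apply: lerD; apply: le_content; split=> x.
- rewrite contfun_mul_val; have /andP[? ?] := g01 x; have /andP[? ?] := h01 x.
  by rewrite mulr_ge0// mulr_ile1.
- by move=> /h0 hx; rewrite contfun_mul_val hx mulr0.
- rewrite contfun_mul_val contfunB contfun_cst_val.
  have /andP[? ?] := g01 x; have /andP[? ?] := h01 x.
  by rewrite mulr_ge0 ?mulr_ile1//; lra.
- move=> nO2; rewrite contfun_mul_val contfunB contfun_cst_val.
  have [Sx|nS] := pselect (S x); last by rewrite gS// mul0r.
  by rewrite h1// subrr mulr0.
Qed.

(** The closed set carrying a truncated function is compact, which reduces the
    countable union to a finite one. *)
Lemma content_bigcup (O : (set K)^nat) : (forall n, open (O n)) ->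
  ((content (\bigcup_n O n))%:E <= \sum_(n <oo) (content (O n))%:E)%E.
Proof.
move=> oO.
have fin n : content (\bigcup_(i in [set i | (i < n)%N]) O i) <=
    \sum_(i < n) content (O i).
  elim: n => [|n ih].
    rewrite big_ord0 [X in content X](_ : _ = set0) ?content_set0//.
    by rewrite -subset0 => x [i].
  rewrite big_ord_recr/=.
  have -> : \bigcup_(i in [set i | (i < n.+1)%N]) O i =
      \bigcup_(i in [set i | (i < n)%N]) O i `|` O n.
    apply/seteqP; split=> [x [i/=]|x [[i /= ni Oi]|On]].
    - by rewrite ltnS leq_eqVlt => /predU1P[->|ni] Oi; [right|left; exists i].
    - by exists i => //=; rewrite ltnW.
    - by exists n => /=.
  apply: le_trans (contentU _ _) _ => //; first exact: bigcup_open.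
  by rewrite lerD2r.
apply/lee_addgt0Pr => e e0; have e2 : 0 < e / 2 by rewrite divr_gt0.
have [_ [f fO <-] fe] := sup_adherent e2 (below_has_sup (\bigcup_n O n)).
have [g [S [gS cS SO]]] := below_truncate fO e2.
have := subclosed_compact cS cK (@subsetT _ S); rewrite compact_cover.
move=> /(_ nat [set: nat] O (fun i _ => oO i) SO)[D' _ SD'].
pose n := (\max_(i <- finmap.enum_fset D') i).+1.
have gn : L g <= \sum_(i < n) content (O i).
  apply: le_trans (fin n); apply: le_content; apply: below_le gS.
  move=> x /SD'[i /= iD Oi]; exists i => //=; rewrite /n ltnS.
  exact: leq_bigmax_seq.
move=> fg; apply: (@le_trans _ _ ((\sum_(i < n) content (O i))%:E + e%:E)%E).
  rewrite -EFinD lee_fin; move: fe; rewrite -/(content _); lra.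
rewrite leeD2r// -sumEFin.
rewrite -(big_mkord xpredT (fun i => (content (O i))%:E)).
by apply: nneseries_lim_ge => i _ _; rewrite lee_fin content_ge0.
Qed.

Local Open Scope ereal_scope.

Definition riesz_outer (A : set K) : \bar R :=
  ereal_inf [set (content O)%:E | O in [set O | open O /\ A `<=` O]].

Lemma riesz_outer_open O : open O -> riesz_outer O = (content O)%:E.
Proof.
move=> oO; apply/eqP; rewrite eq_le; apply/andP; split.
  by apply: ereal_inf_lbound; exists O => //; split.
by apply: le_ereal_inf_tmp => _ [V [oV OV] <-]; rewrite lee_fin content_mono.
Qed.

Lemma riesz_outer_le A O : open O -> A `<=` O -> riesz_outer A <= (content O)%:E.
Proof. by move=> oO AO; apply: ereal_inf_lbound; exists O => //; split. Qed.

Lemma riesz_outer_adherent A (e : R) : (0 < e)%R ->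
  exists V, [/\ open V, A `<=` V & (content V)%:E <= riesz_outer A + e%:E].
Proof.
move=> e0; have fin : riesz_outer A \is a fin_num.
  rewrite ge0_fin_numE.
    by apply: (le_lt_trans (riesz_outer_le openT (@subsetT _ A))); rewrite ltry.
  by apply: le_ereal_inf_tmp => _ [V _ <-]; rewrite lee_fin content_ge0.
have [_ [V [oV AV] <-] /ltW Ve] := lb_ereal_inf_adherent e0 fin.
by exists V.
Qed.

Lemma riesz_outer0 : riesz_outer set0 = 0.
Proof. by rewrite riesz_outer_open ?content_set0//; exact: open0. Qed.

Lemma riesz_outer_ge0 A : 0 <= riesz_outer A.
Proof. by apply: le_ereal_inf_tmp => _ [V _ <-]; rewrite lee_fin content_ge0. Qed.

Lemma le_riesz_outer : {homo riesz_outer : A B / A `<=` B >-> A <= B}.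
Proof.
move=> A B AB; apply/ereal_inf_le_tmp => _ [V [oV BV] <-].
by exists V => //; split => //; exact: subset_trans BV.
Qed.

Lemma riesz_outer_sigma_subadditive : sigma_subadditive riesz_outer.
Proof.
move=> A; apply/lee_addgt0Pr => e e0.
rewrite (le_trans _ (epsilon_trick _ _ (ltW e0)))//; last first.
  by move=> n; exact: riesz_outer_ge0.
have en (n : nat) : (0 < e / (2 ^ n.+1)%:R)%R.
  by rewrite divr_gt0// ltr0n expn_gt0.
have [W WP] := choice (fun n => riesz_outer_adherent (A n) (en n)).
apply: (@le_trans _ _ (content (\bigcup_n W n))%:E).
  apply: riesz_outer_le; first by apply: bigcup_open => n _; case: (WP n).
  by apply: subset_bigcup => n _; case: (WP n).
apply: (le_trans (content_bigcup _)); first by move=> n; case: (WP n).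
apply: lee_nneseries => [n _ _|n _]; first by rewrite lee_fin content_ge0.
by case: (WP n).
Qed.

Definition riesz_outer_measure : {outer_measure set K -> \bar R} :=
  HB.pack riesz_outer (isOuterMeasure.Build R K riesz_outer
    riesz_outer0 riesz_outer_ge0 le_riesz_outer riesz_outer_sigma_subadditive).

(** Cover A by an open V of almost minimal content. A function almost
    optimal for V `&` O has, after truncation, a closed support S, and may be added
    to any function below V \ S without leaving the functions below V. *)
Lemma open_caratheodory O : open O -> riesz_outer_measure.-caratheodory O.
Proof.
move=> oO; apply: (le_caratheodory_measurable (mu := riesz_outer_measure)) => A.
apply/lee_addgt0Pr => e e0; have e2 : (0 < e / 4)%R by rewrite divr_gt0.
have [V [oV AV VA]] := riesz_outer_adherent A e2.
have [_ [f fO <-] fe] := sup_adherent e2 (below_has_sup (V `&` O)).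
have [f' [S [[f'01 f'S] cS SVO ff']]] := below_truncate fO e2.
have oVS : open (V `&` ~` S) by apply: openI => //; exact: closed_openC.
have [_ [g [g01 gS] <-] ge] := sup_adherent e2 (below_has_sup (V `&` ~` S)).
have : (L f' + L g <= content V)%R.
  rewrite -linearD; apply: le_content; split => x.
    rewrite contfunD; have [Sx|nS] := pselect (S x).
      by rewrite (gS x) ?addr0// => -[].
    by rewrite f'S// add0r.
  move=> nV; rewrite contfunD f'S ?gS ?addr0//; first by case.
  by move/SVO => [].
move: fe ge; rewrite -!/(content _) => fe ge Vfg.
have h1 : riesz_outer (A `&` O) <= (content (V `&` O))%:E.
  by apply: riesz_outer_le; [exact: openI|exact: setSI].
have h2 : riesz_outer (A `&` ~` O) <= (content (V `&` ~` S))%:E.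
  apply: riesz_outer_le => // x [/AV Vx nO]; split => // /SVO[]//.
apply: (le_trans (leeD h1 h2)).
have [r rE] : exists r, riesz_outer A = r%:E.
  exists (fine (riesz_outer A)); rewrite fineK// ge0_fin_numE ?riesz_outer_ge0//.
  by apply: (le_lt_trans (riesz_outer_le openT (@subsetT _ A))); rewrite ltry.
move: VA; rewrite -[X in _ <= X + e%:E]/(riesz_outer A) rE -!EFinD !lee_fin => VA.
by clear h1 h2 rE; lra.
Qed.

End RieszContent.

(** * The Riesz representation theorem *)

Section IntegralFunctional.
Context (R : realType) (K : ptopologicalType) (cK : compact [set: K]).
Local Notation CK := (contfun R cK).
Local Notation B := (borelType K).
Implicit Types (f g h : CK) (mu : {finite_measure set B -> \bar R}).

Lemma open_measurable_borel (O : set B) : @open K O -> measurable O.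
Proof. by move=> oO; exact: sub_sigma_algebra. Qed.

Lemma closed_measurable_borel (F : set B) : @closed K F -> measurable F.
Proof.
move=> cF; rewrite -[F]setCK; apply: measurableC; apply: open_measurable_borel.
exact: closed_openC.
Qed.

Lemma contfun_measurable f : measurable_fun [set: B] (f : B -> R).
Proof.
apply: (measurability _ (RGenOInfty.measurableE R)).
move=> _ [_ [x ->] <-]; rewrite setTI; apply: open_measurable_borel.
apply: open_comp => [y _|]; first exact: contfun_continuous.
exact: interval_open.
Qed.

Lemma contfun_integrable mu f : mu.-integrable [set: B] (EFin \o (f : B -> R)).
Proof.
apply: measurable_bounded_integrable => //.
- by rewrite ltey_eq fin_num_measure.
- exact: contfun_measurable.
- exists `|f|; split; first exact: num_real.
  by move=> M fM x _ /=; rewrite (le_trans (le_contfun_norm f x))// ltW.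
Qed.

Definition integral_functional mu (f : CK) : R^o := \int[mu]_x f x.

Lemma integral_functional_linear mu : linear_for *%R (integral_functional mu).
Proof.
move=> a f g; rewrite /integral_functional -RintegralZl//; last first.
  exact: contfun_integrable.
rewrite -RintegralD//; first exact: (contfun_integrable mu (a *: f)).
exact: contfun_integrable.
Qed.

HB.instance Definition _ mu := GRing.isLinear.Build R CK R^o *%R
  (integral_functional mu) (integral_functional_linear mu).

Lemma integral_positive mu : positive (integral_functional mu : {scalar CK}).
Proof. by move=> f f0; apply: Rintegral_ge0. Qed.

Lemma indic_integrable mu (A : set B) : measurable A ->
  mu.-integrable [set: B] (EFin \o (\1_A : B -> R)).
Proof.
move=> mA; apply: measurable_bounded_integrable => //.
  by rewrite ltey_eq fin_num_measure.
exists 1; split; first exact: num_real.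
move=> M M1 x _ /=; rewrite ger0_norm ?indicE//.
by apply: le_trans (ltW M1); case: (_ \in _).
Qed.

Lemma Rintegral_indic mu (A : set B) : measurable A ->
  \int[mu]_x (\1_A x) = fine (mu A).
Proof. by move=> mA; rewrite /Rintegral integral_indic// setIT. Qed.

Lemma integral_ge_measure mu (A : set B) f : measurable A ->
  (forall x, 0 <= f x) -> (forall x, A x -> 1 <= f x) ->
  fine (mu A) <= integral_functional mu f.
Proof.
move=> mA f0 fA; rewrite -Rintegral_indic//; apply: le_Rintegral => //.
- exact: indic_integrable.
- exact: contfun_integrable.
- by move=> x _; rewrite indicE; have [/set_mem/fA|_] := boolP (x \in A).
Qed.

Lemma integral_le_measure mu (A : set B) f : measurable A ->
  (forall x, f x <= 1) -> (forall x, ~ A x -> f x <= 0) ->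
  integral_functional mu f <= fine (mu A).
Proof.
move=> mA f0 fA; rewrite -Rintegral_indic//; apply: le_Rintegral => //.
- exact: contfun_integrable.
- exact: indic_integrable.
- move=> x _; rewrite indicE; have [//|/negP nA] := boolP (x \in A).
  by apply: fA => Ax; apply: nA; rewrite inE.
Qed.

Lemma integral_cst1 mu :
  integral_functional mu (contfun_cst cK 1) = fine (mu [set: B]).
Proof.
apply/eqP; rewrite eq_le; apply/andP; split.
  by apply: integral_le_measure => // x /(_ I).
by apply: integral_ge_measure => // x *; rewrite contfun_cst_val.
Qed.

End IntegralFunctional.

Section Clip.
Context (R : realType).

(** The k-th unit slice of y; the slices of a nonnegative y add up to y. *)
Definition clip (y : R) (k : nat) : R := Num.min (Num.max (y - k%:R) 0) 1.

(** For 0 <= y <= n the right-hand side is y. *)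
Lemma sum_clip (y : R) n : \sum_(k < n) clip y k = Num.min (Num.max y 0) n%:R.
Proof.
elim: n => [|n ih].
  by rewrite big_ord0; apply/esym/min_idPr; rewrite le_max lexx orbT.
rewrite big_ord_recr/= ih /clip -natr1.
have n0 : 0 <= n%:R :> R by [].
have [yn|yn] := leP y n%:R.
  rewrite [Num.max (y - _) _]max_r ?subr_le0// [X in _ + X]min_l ?ler01// addr0.
  have m : Num.max y 0 <= n%:R by rewrite ge_max yn n0.
  by rewrite !min_l//; lra.
rewrite [Num.max y 0]max_l; last by lra.
rewrite [Num.min y n%:R]min_r; last by lra.
rewrite [Num.max _ 0]max_l; last by lra.
have [y1|y1] := leP (y - n%:R) 1.
  by rewrite min_l; lra.
by rewrite min_r; lra.
Qed.

Lemma archimedean_le (x y c : R) :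
  (forall n, n.+1%:R * x <= c + n.+1%:R * y) -> x <= y.
Proof.
move=> h; rewrite leNgt; apply/negP; rewrite -subr_gt0 => d0.
have := h (Num.truncn (c / (x - y))).
have := truncnS_gt (c / (x - y)).
by rewrite ltr_pdivrMr// mulrBr; lra.
Qed.

End Clip.

Section Riesz.
Context (R : realType) (K : ptopologicalType) (cK : compact [set: K]).
Context (hK : hausdorff_space K).
Local Notation CK := (contfun R cK).
Local Notation B := (borelType K).

(** Squeezing a set between a closed and an open one. For finite measures this
    amounts to regularity, and it is visibly inherited by restrictions. *)
Definition tight (mu : {measure set B -> \bar R}) :=
  forall A : set B, measurable A -> forall e : R, 0 < e ->
  exists F O : set B, [/\ @closed K F, @open K O, F `<=` A, A `<=` O &
    (mu (O `\` F) <= e%:E)%E].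

Lemma tight_regular (mu : {finite_measure set B -> \bar R}) :
  tight mu -> regular_measure mu.
Proof.
move=> tmu A mA; split; apply/eqP; rewrite eq_le; apply/andP; split.
- apply: le_ereal_inf_tmp => _ [V [oV AV] <-]; apply: le_measure => //.
    by rewrite inE.
  by rewrite inE; exact: open_measurable_borel.
- apply/lee_addgt0Pr => e e0; have [F [W [cF oO FA AO OF]]] := tmu A mA e e0.
  apply: (@le_trans _ _ (mu W)); first by apply: ereal_inf_lbound; exists W.
  have mO := open_measurable_borel oO; have mF := closed_measurable_borel cF.
  have -> : W = A `|` (W `\` A) by rewrite setDUK.
  rewrite measureU//; [|exact: measurableD|by rewrite setDIK].
  rewrite leeD2l//; apply: le_trans OF; apply: le_measure; rewrite ?inE.
  + exact: measurableD.
  + exact: measurableD.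
  + exact: setDS.
- apply/lee_addgt0Pr => e e0; have [F [W [cF oO FA AO OF]]] := tmu A mA e e0.
  have mO := open_measurable_borel oO; have mF := closed_measurable_borel cF.
  apply: (@le_trans _ _ (mu F + e%:E)%E); last first.
    rewrite leeD2r//; apply: ereal_sup_ubound; exists F => //; split => //.
    exact: (subclosed_compact cF cK).
  have -> : A = F `|` (A `\` F) by rewrite setDUK.
  rewrite measureU//; [|exact: measurableD|by rewrite setDIK].
  rewrite leeD2l//; apply: le_trans OF; apply: le_measure; rewrite ?inE.
  + exact: measurableD.
  + exact: measurableD.
  + exact: setSD.
- apply: ge_ereal_sup => _ [F [cF FA] <-]; apply: le_measure => //.
    rewrite inE; apply: closed_measurable_borel.
    exact: compact_closed.
  by rewrite inE.
Qed.

Context (L : {scalar CK}) (L_ge0 : positive L).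

Let m := riesz_outer_measure hK L_ge0.

Let measurable_cara (A : set B) : measurable A -> m.-cara.-measurable A.
Proof.
apply: smallest_sub; last by move=> O oO; exact: open_caratheodory.
split.
- exact: measurable0.
- by move=> X mX; rewrite setTD; exact: measurableC.
- by move=> F mF; exact: bigcupT_measurable.
Qed.

Definition riesz_measure : set B -> \bar R := m.

Let riesz0 : riesz_measure set0 = 0%E. Proof. exact: outer_measure0. Qed.

Let riesz_ge0 A : (0 <= riesz_measure A)%E.
Proof. exact: outer_measure_ge0. Qed.

Let riesz_sigma_additive : semi_sigma_additive riesz_measure.
Proof.
move=> F mF tF mUF; rewrite /riesz_measure.
apply: caratheodory_measure_sigma_additive => //; last exact: measurable_cara.
by move=> i; exact: measurable_cara.
Qed.

Let riesz_open (O : set B) : @open K O ->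
  riesz_measure O = (content L O)%:E.
Proof. exact: riesz_outer_open. Qed.

Let riesz_finite : fin_num_fun riesz_measure.
Proof.
move=> A mA; rewrite ge0_fin_numE//.
apply: (le_lt_trans (le_outer_measure m _ _ (@subsetT _ A))).
by rewrite -/(riesz_measure _) riesz_open ?ltry//; exact: openT.
Qed.

HB.instance Definition _ := isMeasure.Build _ B R riesz_measure
  riesz0 riesz_ge0 riesz_sigma_additive.
HB.instance Definition _ := Measure_isFinite.Build _ B R riesz_measure
  riesz_finite.

Local Notation mu := (riesz_measure : {finite_measure set B -> \bar R}).

Let mu_open (O : set B) : @open K O -> mu O = (content L O)%:E.
Proof. exact: riesz_outer_open. Qed.

Lemma riesz_measure_tight : tight mu.
Proof.
have outer (A : set B) : measurable A -> forall e : R, 0 < e ->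
    exists V, [/\ @open K V, A `<=` V & (mu (V `\` A) <= e%:E)%E].
  move=> mA e e0; have [V [oV AV VA]] := riesz_outer_adherent L_ge0 A e0.
  exists V; split => //; have mV := open_measurable_borel oV.
  rewrite measureD// ?(setIidr AV); last by rewrite ltey_eq fin_num_measure.
  by rewrite leeBlDr ?fin_num_measure// addeC; move: VA; rewrite -mu_open.
move=> A mA e e0; have e2 : 0 < e / 2 by rewrite divr_gt0.
have [V [oV AV VA]] := outer A mA _ e2.
have [W [oW AW WA]] := outer _ (measurableC mA) _ e2.
have mV := open_measurable_borel oV; have mW := open_measurable_borel oW.
exists (~` W), V; split => //.
- exact: open_closedC.
- by move=> x nW; apply: contrapT => /AW.
apply: (@le_trans _ _ (mu ((V `\` A) `|` (W `\` ~` A)))).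
  apply: le_measure; rewrite ?inE.
  - by apply: measurableD => //; exact: measurableC.
  - by apply: measurableU; apply: measurableD => //; exact: measurableC.
  move=> x [Vx /contrapT Wx]; have [Ax|nA] := pselect (A x); [right|left] => //.
  by split => //; apply.
apply: (le_trans (measureU2 _ _ _)).
- exact: measurableD.
- by apply: measurableD => //; exact: measurableC.
by rewrite [e]splitr EFinD leeD.
Qed.

Let mu_setT : fine (mu [set: B]) = L (contfun_cst cK 1).
Proof. by rewrite -contentT//; exact: (congr1 fine (mu_open openT)). Qed.

(** Slice n f into its n levels fk k. The open set {n f > k + 1} separates
    consecutive slices, as fk (k + 1) is below it and fk k is 1 on it; hence
    L (fk (k + 1)) <= int (fk k). Summing, n L f exceeds n int f by at most L 1. *)
Let unit_le (f : CK) : (forall x, 0 <= f x <= 1) -> L f <= integral_functional mu f.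
Proof.
move=> f01; pose c := L (contfun_cst cK 1).
have c0 : 0 <= c by apply: L_ge0 => x; rewrite contfun_cst_val ler01.
apply: (@archimedean_le _ _ _ c) => n.
pose fk k := contfun_min (contfun_max
  (n.+1%:R *: f - contfun_cst cK k%:R) 0) (contfun_cst cK 1).
have fkE k x : fk k x = clip (n.+1%:R * f x) k by [].
have fk01 k x : 0 <= fk k x <= 1.
  by rewrite fkE /clip le_min le_max lexx orbT ler01 ge_min lexx orbT.
have sumf (G : {scalar CK}) : n.+1%:R * G f = \sum_(k < n.+1) G (fk k).
  rewrite -linear_sum -linearZ; congr (G _); apply/contfunP => x.
  rewrite contfunZ.
  have -> : (\sum_(k < n.+1) fk k : CK) x = \sum_(k < n.+1) clip (n.+1%:R * f x) k.
    by elim/big_ind2 : _ => // ? ? ? ? <- <-.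
  rewrite sum_clip; have /andP[f0 f1] := f01 x.
  rewrite max_l ?mulr_ge0// min_l//.
  by rewrite -[leRHS]mulr1 ler_wpM2l.
have lek k : L (fk k.+1) <= integral_functional mu (fk k).
  pose V := (n.+1%:R *: f) @^-1` [set r | k.+1%:R < r].
  have oV : open V.
    apply: open_comp; last exact: open_gt.
    by move=> x _; exact: contfun_continuous.
  apply: (@le_trans _ _ (fine (mu V))).
    have -> : fine (mu V) = content L V by exact: (congr1 fine (mu_open oV)).
    apply: le_content => //; split => [x|x nV]; first exact: fk01.
    rewrite fkE /clip max_r ?min_l ?ler01// subr_le0 leNgt; exact/negP.
  apply: integral_ge_measure; first exact: open_measurable_borel.
    by move=> x; case/andP: (fk01 k x).
  move=> x Vx; rewrite fkE /clip le_min lexx andbT le_max.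
  have : k.+1%:R < n.+1%:R * f x by [].
  by rewrite -(@natr1 _ k) => /ltW; rewrite -lerBrDl => ?; apply/orP; left; lra.
rewrite !sumf big_ord_recl; apply: lerD.
  apply: positive_le => // x; rewrite contfun_cst_val.
  by case/andP: (fk01 0%N x).
rewrite [leRHS]big_ord_recr/= -[leLHS]addr0; apply: lerD.
  by apply: ler_sum => k _; exact: lek.
by apply: integral_positive => x; case/andP: (fk01 n x).
Qed.

(** The inequality unit_le for f and for 1 - f is an equality. *)
Lemma riesz_measureE (f : CK) : L f = integral_functional mu f.
Proof.
have h (g : CK) : (forall x, 0 <= g x <= 1) -> L g = integral_functional mu g.
  move=> g01; apply/eqP; rewrite eq_le unit_le//=.
  have := @unit_le (contfun_cst cK 1 - g).
  rewrite (linearB L) (linearB (integral_functional mu))/=.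
  rewrite integral_cst1 mu_setT => H.
  have /H : forall x, 0 <= (contfun_cst cK 1 - g : CK) x <= 1.
    by move=> x; rewrite contfunB contfun_cst_val; have := g01 x; lra.
  lra.
pose M := `|f| + 1; have M0 : 0 < M by rewrite ltr_wpDl.
have [g g01 ->] : exists2 g : CK, (forall x, 0 <= g x <= 1) &
    f = (2 * M) *: g - M *: contfun_cst cK 1.
  exists ((2 * M)^-1 *: (f + contfun_cst cK M)); last first.
    rewrite scalerA mulfV ?scale1r; last by rewrite mulf_neq0 ?gt_eqF.
    by rewrite -contfun_cstE addrK.
  move=> x; rewrite contfunZ contfunD contfun_cst_val.
  have := le_contfun_norm f x; rewrite ler_norml => fx.
  rewrite mulr_ge0 ?invr_ge0 ?mulr_ge0 ?(ltW M0)//=; last by rewrite /M; lra.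
  by rewrite ler_pdivrMl ?mulr_gt0// mulr1 /M; lra.
rewrite (linearB L) (linearB (integral_functional mu))/=.
rewrite !(scalarZ L) !(scalarZ (integral_functional mu)) /= h//.
by rewrite integral_cst1 mu_setT.
Qed.

End Riesz.

Theorem riesz_representation (R : realType) (K : ptopologicalType)
  (cK : compact [set: K]) (hK : hausdorff_space K) (L : {scalar contfun R cK}) :
  positive L -> exists mu : {finite_measure set (borelType K) -> \bar R},
    tight mu /\ forall f, L f = integral_functional mu f.
Proof.
move=> L0; exists (riesz_measure hK L0 : {finite_measure set _ -> \bar R}); split.
  exact: riesz_measure_tight.
exact: riesz_measureE.
Qed.

(** * Total variation, dual norm and restriction *)

Section Measures.
Context (R : realType) (K : ptopologicalType) (cK : compact [set: K]).
Context (hK : hausdorff_space K).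
Local Notation CK := (contfun R cK).
Local Notation B := (borelType K).
Implicit Types (mu nu : {finite_measure set B -> \bar R}).
Implicit Types (a b : probability B R).

Lemma fine_measureD mu (A C : set B) : measurable A -> measurable C ->
  fine (mu A) = fine (mu (A `&` C)) + fine (mu (A `\` C)).
Proof.
move=> mA mC; rewrite -fineD ?fin_num_measure//; last 2 first.
  exact: measurableI.
  exact: measurableD.
by rewrite addeC -measureDI.
Qed.

Lemma fine_measure_le mu (A C : set B) : measurable A -> measurable C ->
  A `<=` C -> fine (mu A) <= fine (mu C).
Proof.
by move=> mA mC AC; rewrite fine_le ?fin_num_measure// le_measure// inE.
Qed.

Lemma regular_outer_open mu (A : set B) (e : R) : regular_measure mu ->
  measurable A -> 0 < e ->
  exists V, [/\ @open K V, A `<=` V & fine (mu V) <= fine (mu A) + e].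
Proof.
move=> rmu mA e0; have [Einf _] := rmu A mA.
have fin : ereal_inf [set mu O | O in [set O | @open K O /\ A `<=` O]] \is a fin_num.
  by rewrite -Einf fin_num_measure.
have [_ [V [oV AV] <-] Ve] := lb_ereal_inf_adherent e0 fin.
exists V; split => //; have mV := open_measurable_borel oV.
rewrite -lee_fin EFinD !fineK ?fin_num_measure//.
by move/ltW : Ve; rewrite -Einf.
Qed.

Lemma regular_inner_closed mu (A : set B) (e : R) : regular_measure mu ->
  measurable A -> 0 < e ->
  exists F, [/\ @closed K F, F `<=` A & fine (mu A) <= fine (mu F) + e].
Proof.
move=> rmu mA e0; have [_ Esup] := rmu A mA.
have fin : ereal_sup [set mu F | F in [set F | @compact K F /\ F `<=` A]] \is a fin_num.
  by rewrite -Esup fin_num_measure.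
have [_ [F [cF FA] <-] Fe] := ub_ereal_sup_adherent e0 fin.
have cF' := compact_closed hK cF.
exists F; split => //; have mF := closed_measurable_borel cF'.
rewrite -lerBlDr -lee_fin EFinB !fineK ?fin_num_measure//.
by move/ltW : Fe; rewrite -Esup.
Qed.

Lemma is_probability_on_cutoff a U : open U -> is_probability_on U a ->
  forall e : R, 0 < e -> exists f : CK,
    [/\ forall x, 0 <= f x <= 1, forall x, ~ U x -> f x = 0 &
        1 - e <= integral_functional a f].
Proof.
move=> oU [ra aU] e e0.
have [F [cF FU aF]] := regular_inner_closed ra (open_measurable_borel oU) e0.
have [f [f01 f1 f0]] := urysohn_contfun R cK hK cF oU FU.
exists f; split => //; rewrite lerBlDr.
have -> : 1 = fine (a U) by rewrite aU.
apply: (le_trans aF); rewrite lerD2r; apply: integral_ge_measure => //.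
- exact: closed_measurable_borel.
- by move=> x; case/andP: (f01 x).
- by move=> x Fx; rewrite f1.
Qed.

Lemma charge_subE a b (A : set B) : measurable A ->
  fine (charge_sub a b A) = fine (a A) - fine (b A).
Proof.
move=> mA; rewrite /charge_sub /= /cadd /copp /charge_of_finite_measure /=.
by rewrite fineB ?fin_num_measure.
Qed.

(** P is the positive set of a Hahn decomposition; both measures have mass 1, so
    the negative part contributes as much as the positive one. *)
Lemma tvnorm_probability a b : exists P : set B,
  [/\ measurable P, tvnorm (charge_sub a b) = 2 * (fine (a P) - fine (b P)) &
  forall A, measurable A -> fine (a A) - fine (b A) <= fine (a P) - fine (b P)].
Proof.
rewrite /tvnorm; set H := hahn_sets _; case: H => -[P N]/= PN.
move: (PN) => [[mP posP] [mN negN] PNT PN0].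
have NE : N = ~` P.
  apply/seteqP; split=> x.
    by move=> Nx Px; suff : set0 x by []; rewrite -PN0; split.
  by move=> nPx; have : setT x by []; rewrite -PNT => -[].
have pC (c : probability B R) : fine (c N) = 1 - fine (c P) :> R.
  by rewrite NE probability_setC// fineB ?fin_num_measure.
exists P; split => //.
  rewrite /charge_variation/= jordan_posE cjordan_posE jordan_negE cjordan_negE.
  rewrite /crestr0 mem_set// /crestr !setTI fineD; last 2 first.
  - by rewrite fin_num_measure.
  - by rewrite fin_numN fin_num_measure.
  by rewrite fineN !charge_subE// !pC; lra.
move=> A mA.
have nuN (c : probability B R) :
    fine (c A) = fine (c (A `&` P)) + fine (c (A `\` P)) :> R.
  exact: fine_measureD.
have nuP (c : probability B R) :
    fine (c P) = fine (c (A `&` P)) + fine (c (P `\` A)) :> R.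
  by rewrite setIC; exact: fine_measureD.
have mAP : measurable (A `\` P) by exact: measurableD.
have mPA : measurable (P `\` A) by exact: measurableD.
have h1 : fine (charge_sub a b (A `\` P)) <= 0.
  by apply: fine_le0; apply: negN => // x [Ax nPx]; rewrite NE.
have h2 : 0 <= fine (charge_sub a b (P `\` A)).
  by apply: fine_ge0; apply: posP => // x [].
by move: h1 h2; rewrite !charge_subE// !nuN !nuP; lra.
Qed.

Lemma eq_subE (x y z t : \bar R) : x \is a fin_num -> y \is a fin_num ->
  z \is a fin_num -> t \is a fin_num -> (x - y = z - t -> z + y = t + x)%E.
Proof.
case: x y z t => [x| |] [y| |] [z| |] [t| |]//= _ _ _ _ [] ?.
by congr (_%:E); lra.
Qed.

(** Compare jordan_pos + b and jordan_neg + a, which are equal as measures. *)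
Lemma charge_integral_sub a b (f : CK) :
  charge_integral (charge_sub a b) f =
  integral_functional a f - integral_functional b f.
Proof.
rewrite /charge_integral; set H := hahn_sets _; case: H => -[P N]/= PN.
set jp := jordan_pos PN; set jn := jordan_neg PN.
have e : (\int[measure_add jp b]_x (f x)%:E = \int[measure_add jn a]_x (f x)%:E)%E.
  apply: eq_measure_integral => A mA _.
  rewrite -[LHS]/(measure_add jp b A) -[RHS]/(measure_add jn a A) !measure_addE.
  have : (a A - b A = jp A - jn A)%E.
    by have := jordan_decomp PN mA; rewrite /cadd/= cscaleN1.
  by apply: eq_subE; exact: fin_num_measure.
have int (c : {finite_measure set B -> \bar R}) := contfun_integrable c f.
have fin (c : {finite_measure set B -> \bar R}) :
    (\int[c]_x (f x)%:E)%E \is a fin_num.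
  exact: integrable_fin_num (int c).
have iadd (m1 m2 : {finite_measure set B -> \bar R}) :
    (\int[measure_add m1 m2]_x (f x)%:E =
     \int[m1]_x (f x)%:E + \int[m2]_x (f x)%:E)%E.
  apply: integral_measure_add => //; try exact: int.
rewrite (iadd jp b) (iadd jn a) in e.
rewrite /integral_functional /Rintegral.
have arith (x y z t : R) : x + y = z + t -> x - z = t - y by lra.
by apply: arith; rewrite -!fineD; try exact: fin; rewrite e.
Qed.

Lemma integral_probability_cst1 a : integral_functional a (contfun_cst cK 1) = 1.
Proof. by rewrite integral_cst1; exact: (congr1 fine (probability_setT a)). Qed.

Section dual_norm.
Variable Z : closedSubspace CK.

Lemma dual_norm_le a b (c : R) :
  (forall z, csub Z z -> `|z| <= 1 ->
    `|integral_functional a z - integral_functional b z| <= c) ->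
  dual_norm Z (charge_sub a b) <= c.
Proof.
move=> h; apply: ge_sup.
  exists `|charge_integral (charge_sub a b) (0 : CK)|, 0 => //; split.
    exact: csub0.
  by rewrite normr0 ler01.
by move=> _ [z [Zz z1] <-]; rewrite charge_integral_sub; exact: h.
Qed.

Lemma probability_integral_norm a (f : CK) : `|integral_functional a f| <= `|f|.
Proof.
have /= := positive_norm f (integral_positive (cK := cK) a).
by rewrite integral_probability_cst1 mul1r.
Qed.

Lemma le_dual_norm1 a b z : csub Z z -> `|z| <= 1 ->
  `|integral_functional a z - integral_functional b z| <=
  dual_norm Z (charge_sub a b).
Proof.
move=> Zz z1; rewrite -charge_integral_sub; apply: ub_le_sup; last by exists z.
exists 2 => _ [w [Zw w1] <-]; rewrite charge_integral_sub.
apply: (le_trans (ler_normB _ _)).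
have := probability_integral_norm a w; have := probability_integral_norm b w.
lra.
Qed.

Lemma le_dual_norm a b z : csub Z z ->
  `|integral_functional a z - integral_functional b z| <=
  dual_norm Z (charge_sub a b) * `|z|.
Proof.
move=> Zz; have [->|z0] := eqVneq z 0.
  rewrite (linear0 (integral_functional a)) (linear0 (integral_functional b)).
  by rewrite subrr !normr0 mulr0.
have nz0 : 0 < `|z| by rewrite normr_gt0.
rewrite -ler_pdivrMr// mulrC -[`|z|^-1]gtr0_norm ?invr_gt0// -normrM mulrBr.
rewrite -(scalarZ (integral_functional a)) -(scalarZ (integral_functional b)).
apply: le_dual_norm1; first exact: csubZ.
by rewrite normrZ gtr0_norm ?invr_gt0// mulVf// gt_eqF.
Qed.

End dual_norm.

(** The remainder rho is kept explicitly, so that integrals against mu and pi can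
    be compared without further limiting arguments. *)
Lemma normalized_restriction mu (U : set B) : tight mu -> @open K U ->
  0 < fine (mu U) -> exists (pi : probability B R)
    (rho : {finite_measure set B -> \bar R}),
  [/\ is_probability_on U pi, forall A, rho A = mu (A `\` U) &
   forall f : CK, integral_functional mu f =
     fine (mu U) * integral_functional pi f + integral_functional rho f].
Proof.
move=> tmu oU U0; have mU := open_measurable_borel oU; have mCU := measurableC mU.
have lty (A : set B) : measurable A -> (mu A < +oo)%E.
  by move=> mA; rewrite ltey_eq fin_num_measure.
pose rho : {finite_measure set B -> \bar R} := mfrestr mCU (lty _ mCU).
pose muU : {measure set B -> \bar R} := mfrestr mU (lty _ mU).
pose pi : probability B R := mnormalize muU point.
have muUE : mu U = (fine (mu U))%:E by rewrite fineK// fin_num_measure.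
have piE A : (pi A = mu (A `&` U) * (fine (mu U))^-1%:E)%E.
  have muUT : muU [set: B] = mu U by rewrite /muU/= /mfrestr /mrestr setTI.
  rewrite /pi/= /mnormalize muUT muUE eqe gt_eqF//.
have tpi : is_probability_on U pi.
  split; last by rewrite piE setIid muUE -EFinM divff// gt_eqF.
  apply: tight_regular => // A mA e e0.
  have [F [W [cF oW FA AW WF]]] := tmu A mA _ (mulr_gt0 e0 U0).
  exists F, W; split => //.
  rewrite [X in (X <= _)%E](_ : _ =
    (mu ((W `\` F) `&` U) * (fine (mu U))^-1%:E)%E); last exact: piE.
  have mWF : measurable (W `\` F).
    apply: measurableD; first exact: open_measurable_borel.
    exact: closed_measurable_borel.
  apply: (@le_trans _ _ ((e * fine (mu U))%:E * (fine (mu U))^-1%:E)%E).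
    rewrite lee_pmul2r//; last by rewrite lte_fin invr_gt0.
    apply: le_trans WF; apply: le_measure; rewrite ?inE//.
    exact: measurableI.
  by rewrite -EFinM lee_fin mulfK// gt_eqF.
exists pi, rho; split => //.
have r0 : 0 <= fine (mu U) by rewrite ltW.
have muE A : measurable A ->
    mu A = measure_add (mscale (NngNum r0) pi) rho A.
  move=> mA; rewrite measure_addE.
  rewrite [X in (X + _)%E](_ : _ = mu (A `&` U)).
    rewrite [X in (_ + X)%E](_ : _ = mu (A `\` U)); last by rewrite setDE.
    by rewrite (measureDI mu mA mU) addeC.
  transitivity ((fine (mu U))%:E * pi A)%E; first by [].
  by rewrite piE muleC -muleA -EFinM mulVf ?mule1// gt_eqF.
have ge0 (f : CK) : (forall x, 0 <= f x) -> integral_functional mu f =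
     fine (mu U) * integral_functional pi f + integral_functional rho f.
  move=> f0; rewrite /integral_functional /Rintegral.
  have f0' x : (0 <= (f x)%:E)%E by rewrite lee_fin.
  have mf : measurable_fun [set: B] (fun x : B => (f x)%:E).
    exact: measurableT_comp (contfun_measurable f).
  rewrite (@eq_measure_integral _ B R setT (measure_add (mscale (NngNum r0) pi) rho)).
    rewrite ge0_integral_measure_add// ge0_integral_mscale//= fineD.
    - by rewrite fineM// (integrable_fin_num _ (contfun_integrable _ _)).
    - by rewrite fin_numM// (integrable_fin_num _ (contfun_integrable _ _)).
    - exact: (integrable_fin_num _ (contfun_integrable _ _)).
  by move=> A mA _; exact: muE.
move=> f; pose c := contfun_cst cK `|f|.
have fE : f = (f + c) - c by rewrite addrK.
have c0 x : 0 <= c x by rewrite contfun_cst_val.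
have fc0 x : 0 <= (f + c : CK) x.
  rewrite contfunD contfun_cst_val; have := le_contfun_norm f x.
  by rewrite ler_norml; lra.
rewrite {1 2 3}fE !linearB/= (ge0 c)// (ge0 (f + c))//; lra.
Qed.

End Measures.

(** * The Daugavet property in terms of functionals *)

Lemma slice_arith (R : realFieldType) (G t m d N a b g : R) :
  0 < G -> 0 < N -> 0 <= d -> 0 <= b -> N * G <= t ->
  m <= d -> m <= d * G -> m <= d * (N / 2) -> m <= G * N / 2 ->
  a <= 1 -> b * G <= t -> g <= G -> 1 + t - m < a + b * g ->
  [/\ 1 - d <= a, N - d <= b & G - d <= g].
Proof.
move=> G0 N0 d0 b0 Nt m1 m2 m3 m4 a1 bt gG lt.
have bg : b * g <= b * G by rewrite ler_wpM2l.
have h1 : N - d <= b by rewrite -(ler_pM2r G0) mulrBl; lra.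
have h2 : N / 2 <= b by rewrite -(ler_pM2r G0) mulrAC [N * G]mulrC; lra.
have b1 : 0 < b by lra.
split => //; first by lra.
rewrite -(ler_pM2l b1) mulrBr.
have : d * (N / 2) <= d * b by rewrite ler_wpM2l.
lra.
Qed.

Section DaugavetSlice.
Context (R : realType) (V : normedModType R) (Z : closedSubspace V).
Context (e : {scalar V}) (c : R) (eZ : forall z, csub Z z -> e z = 0).
Context (ec : forall v, `|e v| <= c * `|v|).

Let eq (q : quotient Z) : R := e (repr q).

Let eqE v : eq (qproj Z v) = e v.
Proof.
have /qprojP/eZ : qproj Z (repr (qproj Z v)) = qproj Z v by exact: reprK.
by rewrite (linearB e)/= => /subr0_eq.
Qed.

Let T (g : V) (q : quotient Z) : quotient Z := eq q *: qproj Z g.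

Let T_linear g : linear (T g).
Proof.
move=> a p q; have [u <-] := qproj_surj p; have [v <-] := qproj_surj q.
rewrite qproj_scale qproj_add /T !eqE (linearP e)/=.
by rewrite scalerDl scalerA.
Qed.

HB.instance Definition _ g := GRing.isLinear.Build R (quotient Z) (quotient Z)
  *:%R (T g) (T_linear g).

(** The dual form of the Daugavet property. For T x = e x [g] there is u in the
    unit ball such that the class of u + e u g has norm close to 1 plus that of T.
    A functional y norming that class has y u close to 1 and e u y g close to the
    norm of T, so that both e u and y g are almost as large as they can be. *)
Lemma daugavet_slice (v0 g : V) (d : R) : daugavet (quotient Z) ->
  `|v0| <= 1 -> 0 < e v0 -> 0 < `|qproj Z g| -> 0 < d ->
  exists (y : {scalar V}) u, [/\ forall x, `|y x| <= `|x|,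
    forall z, csub Z z -> y z = 0, `|u| <= 1 &
    [/\ 1 - d <= y u, e v0 - d <= e u & `|qproj Z g| - d <= y g]].
Proof.
move=> DP v01 ev0 G0 d0; set G := `|qproj Z g|.
have c0 : 0 < c.
  have := le_trans (ler_norm _) (ec v0); rewrite ltNge; apply: contraTN => cle0.
  by rewrite -ltNge (le_lt_trans _ ev0)// mulr_le0_ge0.
have eqc q : `|eq q| <= c * `|q|.
  have [v <-] := qproj_surj q; rewrite eqE.
  by apply: le_norm_qproj => //; exact: ltW.
have normT q : `|T g q| = `|eq q| * G by rewrite /T normrZ.
have Tub q : `|q| <= 1 -> `|T g q| <= c * G.
  move=> q1; rewrite normT ler_pM2r//; apply: (le_trans (eqc q)).
  by rewrite -[leRHS]mulr1 ler_pM2l.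
have bT : bounded_near (T g) (nbhs (0 : quotient Z)).
  exists (c * G); split; first exact: num_real.
  move=> M cGM; apply/nbhs_ballP; exists 1 => //= q; rewrite -ball_normE /=.
  rewrite sub0r normrN => /ltW q1; apply: (le_trans (Tub _ q1)); exact: ltW.
have rT : rank_one (T g).
  exists (qproj Z g); first by rewrite -normr_gt0.
  apply/seteqP; split=> [_ [q _ <-]|_ [a _ <-]]; first by exists (eq q).
  exists (qproj Z ((a / e v0) *: v0)) => //.
  by rewrite /T eqE (scalarZ e) divfK// gt_eqF.
have := DP (T g) bT rT; set t := opnorm (T g) => DPT.
have leT q : `|q| <= 1 -> `|eq q| * G <= t.
  move=> q1; rewrite -normT; apply: ub_le_sup; last by exists q.
  by exists (c * G) => _ [p /Tub ? <-].
have tv0 : e v0 * G <= t.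
  have q1 : `|qproj Z v0| <= 1 by rewrite (le_trans (norm_qproj Z v0)).
  by rewrite -eqE; apply: le_trans (leT _ q1); rewrite ler_wpM2r ?ler_norm// ltW.
(* the accuracy m makes every quotient below controlled by d *)
pose m := Num.min (Num.min (G * e v0 / 2) (d * G)) (Num.min d (d * (e v0 / 2))).
have m0 : 0 < m by rewrite /m !lt_min !(mulr_gt0, divr_gt0, d0, G0, ev0, ltr0n).
have [m1 m2 m3 m4] : [/\ m <= G * e v0 / 2, m <= d * G, m <= d & m <= d * (e v0 / 2)].
  have : m <= m by []. 
  by rewrite {2}/m !le_min => /andP[/andP[-> ->] /andP[-> ->]].
have t0 : 0 < t by apply: lt_le_trans tv0; rewrite mulr_gt0.
have [q q1 qlt] : exists2 q, `|q| <= 1 & 1 + t - m < `|q + T g q|.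
  apply: contrapT => h.
  have : 1 + t <= 1 + t - m; last by lra.
  rewrite -[leLHS]DPT; apply: ge_sup.
    by exists `|0 + T g 0|, 0 => //=; rewrite normr0 ler01.
  move=> _ [q q1 <-]; rewrite leNgt; apply/negP => hq.
  by apply: h; exists q.
have [u u1 ult] : exists2 u, `|u| <= 1 & 1 + t - m < `|qproj Z (u + e u *: g)|.
  set X := `|q + T g q| in qlt; set Y := 1 + t - m in qlt *.
  have Y0 : 0 < Y.
    rewrite /Y; have : m <= e v0 * G / 2 by rewrite [e v0 * G]mulrC.
    by move: tv0; lra.
  have X0 : 0 < X by exact: lt_trans qlt.
  (* shrinking q by s keeps the strict inequality and leaves room for a
     representative u inside the unit ball *)
  pose s := (X + Y) / (2 * X).
  have s1 : s < 1 by rewrite /s ltr_pdivrMr ?mulr_gt0//; lra.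
  have s0 : 0 < s by apply: divr_gt0; [exact: addr_gt0|exact: mulr_gt0].
  have s1' : 0 < 1 - s by rewrite subr_gt0.
  have [u uq ule] := norm_qproj_adherent (s *: q) s1'.
  exists u.
    apply/ltW/(lt_le_trans ule); rewrite normrZ gtr0_norm//.
    have : s * `|q| <= s * 1 by rewrite ler_pM2l.
    lra.
  have -> : qproj Z (u + e u *: g) = s *: (q + T g q).
    rewrite -qproj_add -qproj_scale uq -[e u]eqE uq scalerDr /T scalerA.
    congr (_ + _ *: _); have [v <-] := qproj_surj q.
    by rewrite qproj_scale !eqE (scalarZ e).
  rewrite normrZ gtr0_norm// -/X /s -mulrA [_^-1 * X]mulrC invfM mulrA.
  by rewrite mulrCA mulfK ?gt_eqF//; lra.
have [y [y1 yZ yE]] := norming_annihilator Z (u + e u *: g).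
have yu : `|y u| <= 1 by rewrite (le_trans (y1 u)).
have yg : `|y g| <= G.
  have := @le_norm_qproj _ _ Z y 1 g ler01; rewrite mul1r.
  by apply => // v; rewrite mul1r.
have eu : `|e u| * G <= t.
  by rewrite -eqE; apply: leT; rewrite (le_trans (norm_qproj Z u)).
move: ult; rewrite -yE (linearD y)/= (scalarZ y) => ult.
have pos (x : R) : 0 < x -> 0 <= x by move/ltW.
(* when e u < 0 the pair (- y, - u) is used instead of (y, u) *)
have key (y' : {scalar V}) u' : (forall x, `|y' x| = `|y x|) -> `|e u'| = `|e u| ->
    y' u' + e u' * y' g = y u + e u * y g -> `|u'| <= 1 -> 0 <= e u' ->
    (forall z, csub Z z -> y' z = 0) ->
  exists (y : {scalar V}) u, [/\ forall x, `|y x| <= `|x|,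
    forall z, csub Z z -> y z = 0, `|u| <= 1 &
    [/\ 1 - d <= y u, e v0 - d <= e u & G - d <= y g]].
  move=> yy' ee' E u'1 eu'0 y'Z; exists y', u'; split => //.
    by move=> x; rewrite yy'.
  rewrite -E in ult; apply: (slice_arith G0 ev0 (ltW d0) eu'0 tv0 m3 m2 m4 m1 _ _ _ ult).
  - by rewrite (le_trans (ler_norm _))// yy' (le_trans (y1 u')).
  - by rewrite -(ger0_norm eu'0) ee'.
  - by rewrite (le_trans (ler_norm _))// yy'.
have [eu0|eu0] := leP 0 (e u); first exact: (key y u).
have [y' y'E] := scalar_combination (- 1) 0 y y.
have y'N x : y' x = - y x by rewrite y'E mul0r addr0 mulN1r.
apply: (key y' (- u)).
- by move=> x; rewrite y'N normrN.
- by rewrite (linearN e) normrN.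
- by rewrite !y'N (linearN e) (linearN y)/= mulrNN opprK.
- by rewrite normrN.
- by rewrite (linearN e)/= oppr_ge0 ltW.
- by move=> z Zz; rewrite y'N yZ// oppr0.
Qed.

End DaugavetSlice.

(** * Poor subspaces admit singular approximation *)

Section KernelSubspace.
Context (R : realType) (V : normedModType R).

Lemma kernel_subspace (Z : closedSubspace V) (lam : {scalar V}) (c : R) :
  (forall v, `|lam v| <= c * `|v|) ->
  exists Z' : closedSubspace V, forall z, csub Z' z <-> csub Z z /\ lam z = 0.
Proof.
move=> lamc; pose S := [set z | csub Z z /\ lam z = 0].
have Ssub : submod_closed (mem S).
  split; first by apply/mem_set; split; [exact: csub0|exact: linear0].
  move=> a u v /set_mem[Zu u0] /set_mem[Zv v0]; apply/mem_set; split.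
    exact: csubZD.
  by rewrite (linearP lam) u0 v0/= mulr0 addr0.
have Sclosed : closed S.
  move=> x clx; split.
    apply: (csub_closed (c := Z)) => B /clx[y [[Zy _] By]].
    by exists y.
  apply/eqP; rewrite -normr_le0; apply/ler_addgt0Pr => e e0; rewrite add0r.
  have c1 : 0 < `|c| + 1 by rewrite ltr_wpDl.
  have [y [[_ y0]]] := clx _ (nbhsx_ballx x _ (divr_gt0 e0 c1)).
  rewrite -ball_normE/= => xy.
  have -> : lam x = lam (x - y) by rewrite (linearB lam)/= y0 subr0.
  apply: (le_trans (lamc _)); apply: (@le_trans _ _ ((`|c| + 1) * `|x - y|)).
    by rewrite ler_wpM2r// (le_trans (ler_norm c))// lerDl.
  by rewrite mulrC -ler_pdivlMr// ltW.
by exists (ClosedSubspace Ssub Sclosed).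
Qed.

(** A functional that vanishes on Z /\ ker lam is, on Z, a multiple of lam. *)
Lemma proportional_on (Z : closedSubspace V) (lam y : {scalar V}) :
  (forall z, csub Z z -> lam z = 0 -> y z = 0) ->
  exists a, forall z, csub Z z -> y z = a * lam z.
Proof.
move=> ylam.
have [[z0 [Zz0 z00]]|none] := pselect (exists z, csub Z z /\ lam z != 0).
  exists (y z0 / lam z0) => z Zz.
  have : y (z - (lam z / lam z0) *: z0) = 0.
    apply: ylam; first by rewrite addrC -scaleNr; exact: csubZD.
    by rewrite (linearB lam)/= (scalarZ lam) divfK// subrr.
  rewrite (linearB y)/= (scalarZ y) => /subr0_eq ->.
  by rewrite mulrAC [RHS]mulrAC [lam z * _]mulrC.
exists 0 => z Zz; rewrite mul0r; apply: ylam => //.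
by apply/eqP; apply: contrapT => /negP lz; apply: none; exists z.
Qed.

End KernelSubspace.

Section PoorApproximation.
Context (R : realType) (K : ptopologicalType) (cK : compact [set: K]).
Context (hK : hausdorff_space K).
Local Notation CK := (contfun R cK).
Local Notation one := (contfun_cst cK 1).
Local Notation unit_fun := (below [set: K]).

(** L1 - L2 is a functional of norm at most 1 that equals a lam on Z, and that up to
    errors e and e' is a probability measure carried by U and singular to phi:
    L2 has small mass, some function below U almost exhausts L1, and some h with
    values in [0, 1] separates L1 from phi. The exact relation on Z is what makes
    L1 - L2 usable for building further annihilating functionals. *)
Record near_state (Z : closedSubspace CK) (U : set K) (phi lam : {scalar CK})
    (e e' a : R) (L1 L2 : {scalar CK}) : Prop := NearState {
  near_pos1 : positive L1 ;
  near_pos2 : positive L2 ;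
  near_mass : L1 one + L2 one <= 1 ;
  near_neg : L2 one <= e ;
  near_Z : forall z, csub Z z -> L1 z - L2 z = a * lam z ;
  near_support : exists2 f, below U f & 1 - e <= L1 f ;
  near_singular : exists2 h, unit_fun h & 1 - e <= L1 h /\ phi h <= e' }.

Lemma below_max U f g : below U f -> below U g ->
  below U (contfun_max f g : CK).
Proof.
move=> [f01 fU] [g01 gU]; split=> x.
  rewrite contfun_max_val; have /andP[f0 f1] := f01 x; have /andP[g0 g1] := g01 x.
  by rewrite le_max f0 ge_max f1 g1.
by move=> nU; rewrite contfun_max_val fU// gU// maxxx.
Qed.

Lemma le_contfun_maxl L f g : positive L -> L f <= L (contfun_max f g : CK).
Proof.
by move=> L0; apply: positive_le => // x; rewrite contfun_max_val le_max lexx.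
Qed.

Lemma le_contfun_maxr L f g : positive L -> L g <= L (contfun_max f g : CK).
Proof.
move=> L0; apply: positive_le => // x.
by rewrite contfun_max_val le_max lexx orbT.
Qed.

Lemma le_contfun_maxD (L : {scalar CK}) f g : positive L -> unit_fun f -> unit_fun g ->
  L (contfun_max f g) <= L f + L g.
Proof.
move=> L0 [f01 _] [g01 _]; rewrite -(linearD L); apply: positive_le => // x.
rewrite contfun_max_val contfunD.
have /andP[f0 _] := f01 x; have /andP[g0 _] := g01 x.
by rewrite ge_max lerDl lerDr f0 g0.
Qed.

Lemma convexR (s x y c : R) : 0 <= s <= 1 -> x <= c -> y <= c ->
  s * x + (1 - s) * y <= c.
Proof.
move=> /andP[s0 s1] xc yc.
have : s * x <= s * c by rewrite ler_wpM2l.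
have : (1 - s) * y <= (1 - s) * c by rewrite ler_wpM2l// subr_ge0.
lra.
Qed.

(** Pointwise maxima of the witnesses serve for both functionals, which costs
    the sum of the two singularity errors. *)
Lemma near_state_convex Z U phi lam e e1 e2 a b s L1 L2 M1 M2 :
  positive phi -> 0 <= s <= 1 ->
  near_state Z U phi lam e e1 a L1 L2 -> near_state Z U phi lam e e2 b M1 M2 ->
  exists N1 N2,
    near_state Z U phi lam e (e1 + e2) (s * a + (1 - s) * b) N1 N2.
Proof.
move=> phi0 /[dup] s01 /andP[s0 s1] nL nM.
have [N1 N1E] := scalar_combination s (1 - s) L1 M1.
have [N2 N2E] := scalar_combination s (1 - s) L2 M2.
have s1' : 0 <= 1 - s by rewrite subr_ge0.
have convexN (x y c : R) : c <= x -> c <= y -> c <= s * x + (1 - s) * y.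
  by move=> cx cy; have := convexR s01 (_ : - x <= - c) (_ : - y <= - c); lra.
exists N1, N2; split.
- move=> f f0; rewrite N1E addr_ge0// mulr_ge0//.
    exact: (near_pos1 nL).
  exact: (near_pos1 nM).
- move=> f f0; rewrite N2E addr_ge0// mulr_ge0//.
    exact: (near_pos2 nL).
  exact: (near_pos2 nM).
- rewrite N1E N2E; have := convexR s01 (near_mass nL) (near_mass nM); lra.
- by rewrite N2E; apply: convexR => //; [exact: near_neg nL|exact: near_neg nM].
- move=> z Zz; rewrite N1E N2E.
  have := near_Z nL Zz; have := near_Z nM Zz.
  move=> hM hL; transitivity (s * (a * lam z) + (1 - s) * (b * lam z)).
    by rewrite -hL -hM; ring.
  by ring.
- have [f fU fL] := near_support nL; have [g gU gM] := near_support nM.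
  exists (contfun_max f g); first exact: below_max.
  rewrite N1E; apply: convexN.
    by apply: (le_trans fL); apply: le_contfun_maxl; exact: near_pos1 nL.
  by apply: (le_trans gM); apply: le_contfun_maxr; exact: near_pos1 nM.
- have [f fU [fL fphi]] := near_singular nL.
  have [g gU [gM gphi]] := near_singular nM.
  exists (contfun_max f g); first exact: below_max.
  split; last first.
    by apply: (le_trans (le_contfun_maxD phi0 fU gU)); exact: lerD.
  rewrite N1E; apply: convexN.
    by apply: (le_trans fL); apply: le_contfun_maxl; exact: near_pos1 nL.
  by apply: (le_trans gM); apply: le_contfun_maxr; exact: near_pos1 nM.
Qed.

Lemma near_state_le Z U phi lam e e1 d d1 a L1 L2 :
  near_state Z U phi lam e e1 a L1 L2 -> e <= d -> e1 <= d1 ->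
  near_state Z U phi lam d d1 a L1 L2.
Proof.
move=> [p1 p2 m n z [f fU fL] [h hU [hL hphi]]] ed ed1; split=> //.
- exact: le_trans ed.
- by exists f => //; apply: le_trans fL; rewrite lerD2l lerN2.
- exists h => //; split; last exact: le_trans ed1.
  by apply: le_trans hL; rewrite lerD2l lerN2.
Qed.

(** The separating function is (1 + u) / 2. *)
Lemma near_state_intro Z U (phi lam : {scalar CK}) e e1 a (L1 L2 : {scalar CK})
    (f u : CK) :
  positive L1 -> positive L2 -> L1 one + L2 one <= 1 -> phi one = 1 ->
  (forall z, csub Z z -> L1 z - L2 z = a * lam z) ->
  below U f -> 1 - e <= L1 f - L2 f ->
  `|u| <= 1 -> 1 - e <= L1 u - L2 u -> phi u <= - 1 + 2 * e1 ->
  near_state Z U phi lam (2 * e) e1 a L1 L2.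
Proof.
move=> L1p L2p L12 phi1 LZ fU Lf u1 Lu phiu; have [f01 _] := fU.
have ux x : - 1 <= u x <= 1.
  by rewrite -ler_norml (le_trans (le_contfun_norm u x)).
have L1f : L1 f <= L1 one.
  apply: positive_le => // x; rewrite contfun_cst_val.
  by case/andP: (f01 x).
have L2f : 0 <= L2 f by apply: L2p => x; case/andP: (f01 x).
have L20 : 0 <= L2 one by apply: L2p => x; rewrite contfun_cst_val.
have L2u : 0 <= L2 (one + u).
  apply: L2p => x; rewrite contfunD contfun_cst_val -lerBlDl sub0r.
  by case/andP: (ux x).
rewrite (linearD L2)/= in L2u.
split => //; first lra.
  by exists f => //; lra.
exists (2^-1 *: (one + u)).
  split=> x; last by move=> /(_ Logic.I).
  by rewrite contfunZ contfunD contfun_cst_val; have := ux x; lra.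
by rewrite (scalarZ L1) (linearD L1)/= (scalarZ phi) (linearD phi)/= phi1; split; lra.
Qed.

Lemma slice_step (t n e d : R) : 0 < e -> 0 < t -> 0 <= n ->
  4 * (t * n) + 4 * t = e -> d = t * e / 2 -> e <= 1 ->
  d <= e / 2 /\ 0 < 1 - d - t * n.
Proof.
move=> e0 t0 n0 tE dE e1.
have h1 : t * e <= t * 1 by rewrite ler_pM2l.
have h2 : 0 <= t * n by rewrite mulr_ge0// ltW.
by rewrite dE; split; lra.
Qed.

Lemma slice_end (W e0 d e wu wv pu pv : R) : 1 + W - e0 <= wv - pv ->
  wv - pv - d <= wu - pu -> d <= e / 2 -> 0 < e -> wu <= W -> 0 <= e0 ->
  pu <= - 1 + 2 * (e0 + e).
Proof. lra. Qed.

Lemma slice_bounds (t n e d lf lz G yf yz : R) : 0 < e -> 0 < t ->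
  4 * (t * n) + 4 * t = e -> d = t * e / 2 -> e <= 1 -> 0 <= n ->
  1 - d <= lf -> `|lz| <= n -> `|yz| <= n -> yf <= 1 ->
  lf + t * lz <= G -> G - d <= yf + t * yz ->
  1 - e <= yf /\ lz - e <= yz.
Proof.
move=> e0 t0 tE dE e1 n0 lfd; rewrite !ler_norml => /andP[lz1 lz2] /andP[yz1 yz2].
move=> yf1 lG yG.
have h1 : t * yz <= t * n by rewrite ler_pM2l.
have h2 : t * - n <= t * lz by rewrite ler_pM2l.
have h3 : t * e <= t * 1 by rewrite ler_pM2l.
have h4 : 0 <= t * n by rewrite mulr_ge0// ltW.
split; first by lra.
by rewrite -(ler_pM2l t0) mulrBr; lra.
Qed.

Context (Z : closedSubspace CK) (poorZ : poor Z).

Section OneSided.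
Context (U : set K) (phi lam w : {scalar CK}) (W e0 : R) (v0 : CK).
Hypothesis phi_pos : positive phi.
Hypothesis phi1 : phi one = 1.
Hypothesis lam_pos : positive lam.
Hypothesis lam1 : lam one = 1.
Hypothesis lamU : forall d, 0 < d -> exists2 f, below U f & 1 - d <= lam f.
Hypothesis W0 : 0 <= W.
Hypothesis wW : forall v, `|w v| <= W * `|v|.
Hypothesis wphi : forall z, csub Z z -> lam z = 0 -> w z = phi z.
Hypothesis v01 : `|v0| <= 1.
Hypothesis e00 : 0 <= e0 < 1.
Hypothesis v0E : 1 + W - e0 <= w v0 - phi v0.

(** The slice is the one of f + t z1. Since y f <= 1, a value of y at f + t z1 that
    is at least lam (f + t z1) - d forces y z1 >= lam z1 - (2 d) / t, so t has to be
    small compared with e / `|z1| and then d small compared with t e. *)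
Lemma near_state_lower (z1 : CK) (e : R) : 0 < e <= 1 -> exists a L1 L2,
  near_state Z U phi lam (2 * e) (e0 + e) a L1 L2 /\
  lam z1 - e <= L1 z1 - L2 z1.
Proof.
move=> /andP[e_gt0 e_le1].
have lam_le v : `|lam v| <= 1 * `|v| by rewrite -lam1; exact: positive_norm.
have [Z' Z'E] := kernel_subspace Z lam_le.
have DP : daugavet (quotient Z') by apply: poorZ => z /Z'E[].
have [ew ewE] := scalar_combination 1 (- 1) w phi.
have ewZ z : csub Z' z -> ew z = 0.
  by move=> /Z'E[Zz lz]; rewrite ewE wphi//; lra.
have ewc v : `|ew v| <= (W + 1) * `|v|.
  rewrite ewE mul1r mulN1r (le_trans (ler_normB _ _))// mulrDl lerD//.
  by rewrite -phi1; exact: positive_norm.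
pose t := e / (4 * (`|z1| + 1)).
have den0 : 0 < 4 * (`|z1| + 1) by rewrite mulr_gt0// ltr_wpDl.
have t0 : 0 < t by rewrite divr_gt0.
have tE : 4 * (t * `|z1|) + 4 * t = e.
  rewrite /t -[RHS](divfK (_ : 4 * (`|z1| + 1) != 0)) ?gt_eqF//; ring.
clearbody t; pose d := t * e / 2; have dE : d = t * e / 2 by [].
have d0 : 0 < d by rewrite dE !mulr_gt0// invr_gt0.
clearbody d; have [f fU fd] := lamU d0.
have [f01 _] := fU.
pose g := f + t *: z1.
have lamg : lam f + t * lam z1 <= `|qproj Z' g|.
  have -> : lam f + t * lam z1 = lam g by rewrite (linearD lam)/= (scalarZ lam).
  have := @le_norm_qproj _ _ Z' lam 1 g ler01 lam_le; rewrite mul1r => h.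
  by apply: le_trans (h _); [exact: ler_norm|move=> z /Z'E[]].
have lamz1 := lam_le z1; rewrite mul1r in lamz1.
have [e1 ted] : d <= e / 2 /\ 0 < 1 - d - t * `|z1|.
  by apply: slice_step => //.
have G0 : 0 < `|qproj Z' g|.
  apply: lt_le_trans lamg; apply: (lt_le_trans ted); apply: lerD => //.
  by rewrite -mulrN ler_pM2l// lerNl (le_trans _ lamz1)// -normrN ler_norm.
have ev0 : 0 < ew v0.
  rewrite ewE mul1r mulN1r; apply: lt_le_trans v0E; rewrite subr_gt0.
  by case/andP: e00 => _ /lt_le_trans; apply; rewrite lerDl.
have [y [u [y1 yZ' u1 [yu eu yg]]]] := daugavet_slice ewZ ewc DP v01 ev0 G0 d0.
have y1' v : y v <= 1 * `|v| by rewrite mul1r (le_trans (ler_norm _)).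
have [L1 [L2 [L1p L2p L12 yE]]] := jordan_functional ler01 y1'.
have yf1 : y f <= 1.
  rewrite (le_trans (ler_norm _))// (le_trans (y1 f))//.
  apply: contfun_norm_le => // x; have /andP[f0x f1x] := f01 x.
  by rewrite ger0_norm.
have ygE : y g = y f + t * y z1 by rewrite (linearD y)/= (scalarZ y).
rewrite ygE in yg.
have [yf yz] := slice_bounds e_gt0 t0 tE dE e_le1 (normr_ge0 _) fd lamz1 (y1 z1)
  yf1 lamg yg.
have [a aE] : exists a, forall z, csub Z z -> y z = a * lam z.
  by apply: proportional_on => z Zz lz; apply: yZ'; apply/Z'E.
exists a, L1, L2; rewrite -yE; split => //.
apply: (near_state_intro (f := f) (u := u)) => //.
- by move=> z Zz; rewrite -yE aE.
- by rewrite -yE.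
- rewrite -yE; apply: le_trans yu; rewrite lerD2l lerN2 (le_trans e1)//.
  by rewrite ler_pdivrMr// ler_peMr ?ler1n// ltW.
have wu : w u <= W.
  rewrite (le_trans (ler_norm _))// (le_trans (wW u))//.
  by rewrite -[leRHS]mulr1 ler_wpM2l.
rewrite !ewE !mul1r !mulN1r in eu.
by apply: (slice_end v0E eu e1 e_gt0 wu); case/andP: e00.
Qed.

(** Applied to z1 and to - z1 with lam z1 = 1, near_state_lower yields
    coefficients a >= 1 - e and b <= 1 + e; either one of them is within e of 1, or
    a convex combination of the two is exactly 1. *)
Lemma near_state_exists (e : R) : 0 < e <= 1 -> exists a L1 L2,
  near_state Z U phi lam (2 * e) (2 * (e0 + e)) a L1 L2 /\ `|a - 1| <= e.
Proof.
move=> /[dup] e01 /andP[e_gt0 _]; have /andP[e0_ge0 _] := e00.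
have weaken a L1 L2 : near_state Z U phi lam (2 * e) (e0 + e) a L1 L2 ->
    near_state Z U phi lam (2 * e) (2 * (e0 + e)) a L1 L2.
  move=> nL; apply: near_state_le nL _ _ => //.
  by rewrite mulr_natl mulr2n lerDl addr_ge0// ltW.
have [[z0 [Zz0 z00]]|none] := pselect (exists z, csub Z z /\ lam z != 0); last first.
  have [a [L1 [L2 [nL _]]]] := near_state_lower 0 e01.
  exists 1, L1, L2; rewrite subrr normr0 ltW//; split => //.
  have [p1 p2 m n z s h] := weaken _ _ _ nL; split => // v Zv.
  have lv : lam v = 0.
    by apply/eqP; apply: contrapT => /negP lv; apply: none; exists v.
  by rewrite z// lv !mulr0.
pose z1 := (lam z0)^-1 *: z0.
have Zz1 : csub Z z1 by exact: csubZ.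
have lz1 : lam z1 = 1 by rewrite (scalarZ lam) mulVf.
have [a [L1 [L2 [nL]]]] := near_state_lower z1 e01.
rewrite (near_Z nL Zz1) lz1 mulr1 => a1.
have [b [M1 [M2 [nM]]]] := near_state_lower (- z1) e01.
rewrite (near_Z nM (csubN Zz1)) (linearN lam)/= lz1 mulrN1 => b1.
have [a2|a2] := leP a (1 + e).
  exists a, L1, L2; split; first exact: weaken.
  by rewrite ler_norml; lra.
have [b2|b2] := leP (1 - e) b.
  exists b, M1, M2; split; first exact: weaken.
  by rewrite ler_norml; lra.
have ab : 0 < a - b by lra.
pose s := (1 - b) / (a - b).
have s01 : 0 <= s <= 1.
  by rewrite /s divr_ge0/= ?ler_pdivrMr//; lra.
have [N1 [N2 nN]] := near_state_convex phi_pos s01 nL nM.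
exists (s * a + (1 - s) * b), N1, N2; split.
  by have -> : 2 * (e0 + e) = (e0 + e) + (e0 + e) by ring.
have -> : s * a + (1 - s) * b = s * (a - b) + b by ring.
by rewrite /s divfK ?gt_eqF// subrK subrr normr0 ltW.
Qed.

End OneSided.

Lemma poor_near_state (U : set K) (phi lam : {scalar CK}) (e : R) :
  positive phi -> phi one = 1 -> positive lam -> lam one = 1 ->
  (forall d, 0 < d -> exists2 f, below U f & 1 - d <= phi f) ->
  (forall d, 0 < d -> exists2 f, below U f & 1 - d <= lam f) -> 0 < e ->
  exists a L1 L2, near_state Z U phi lam e e a L1 L2 /\ `|a - 1| <= e.
Proof.
move=> phi0 phi1 lam0 lam1 phiU lamU e0.
pose d := Num.min (e / 2) 1 / 100.
have m0 : 0 < Num.min (e / 2) 1 by rewrite lt_min ltr01 divr_gt0.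
have [m1 m2] : Num.min (e / 2) 1 <= e / 2 /\ Num.min (e / 2) 1 <= 1.
  by split; rewrite ge_min lexx ?orbT.
have [d0 d1 de] : [/\ 0 < d, d <= 1 / 100 & d <= e / 200] by rewrite /d; split; lra.
clearbody d; clear m0 m1 m2.
have [d01 d20 de1 de2 de42] :
    [/\ 0 < d <= 1, 0 <= 20 * d < 1, d <= e, 2 * d <= e & 2 * (20 * d + d) <= e].
  by split; lra.
(* first round: both measures are phi, and e = - phi attains its norm at - 1 *)
have [zero zeroE] := scalar_combination 0 0 phi phi.
have zW v : `|zero v| <= 0 * `|v| by rewrite zeroE !mul0r addr0 normr0.
have zphi z : csub Z z -> phi z = 0 -> zero z = phi z.
  by move=> _ ->; rewrite zeroE; lra.
have n1 : `|(- one : CK)| <= 1.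
  rewrite normrN; apply: contfun_norm_le => // x.
  by rewrite contfun_cst_val normr1.
have z1 : 1 + 0 - 0 <= zero (- one) - phi (- one).
  by rewrite zeroE (linearN phi)/= phi1; lra.
have z01 : 0 <= (0 : R) < 1.
  by apply/andP; split; [exact: lexx|exact: ltr01].
have [a1 [M1 [M2 [nM a11]]]] := near_state_exists phi0 phi1 phi0 phi1 phiU (lexx 0) zW
  zphi n1 z01 z1 d01.
rewrite add0r in nM.
have a1_ge : 1 / 2 <= a1 by move: a11; rewrite ler_norml; lra.
have a1_gt0 : 0 < a1 by lra.
have [p1 p2 m n z _ [h [h01 _] [hM hphi]]] := nM.
have ia0 : 0 < a1^-1 by rewrite invr_gt0.
have ia2 : a1^-1 <= 2 by rewrite -[leRHS]invrK lef_pV2 ?posrE ?invr_gt0//; lra.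
(* second round: w = phi on Z, and w - phi almost attains 1 + a1^-1 at 2 h - 1 *)
have [w wE] := scalar_combination a1^-1 (- a1^-1) M1 M2.
pose v0 : CK := 2 *: h - one.
have v01 : `|v0| <= 1.
  apply: contfun_norm_le => // x; rewrite contfunB contfunZ contfun_cst_val.
  by have := h01 x; rewrite ler_norml; lra.
have wW v : `|w v| <= a1^-1 * `|v|.
  rewrite wE mulNr -mulrBr normrM (gtr0_norm ia0) ler_pM2l//.
  apply: (le_trans (ler_normB _ _)).
  have := positive_norm v p1; have := positive_norm v p2.
  have : (M1 one + M2 one) * `|v| <= 1 * `|v| by rewrite ler_wpM2r.
  lra.
have M2h : M2 h <= M2 one.
  by apply: positive_le => // x; rewrite contfun_cst_val; case/andP: (h01 x).
have M2h0 : 0 <= M2 h by apply: p2 => x; case/andP: (h01 x).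
have M20 : 0 <= M2 one by apply: p2 => x; rewrite contfun_cst_val.
have M10 : 0 <= M1 one by apply: p1 => x; rewrite contfun_cst_val.
have v0E : 1 + a1^-1 - 20 * d <= w v0 - phi v0.
  rewrite wE /v0 !linearB/= (scalarZ M1) (scalarZ M2) (scalarZ phi) phi1.
  have X : 1 - 8 * d <= 2 * M1 h - M1 one - (2 * M2 h - M2 one) by lra.
  have : a1^-1 * (1 - 8 * d) <=
      a1^-1 * (2 * M1 h - M1 one - (2 * M2 h - M2 one)) by rewrite ler_pM2l.
  have : a1^-1 * d <= 2 * d by rewrite ler_pM2r.
  lra.
have wphi v : csub Z v -> lam v = 0 -> w v = phi v.
  move=> Zv _; rewrite wE mulNr -mulrBr z//.
  by rewrite mulrA mulVf ?mul1r// gt_eqF.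
have [a [L1 [L2 [nL a_1]]]] := near_state_exists phi0 phi1 lam0 lam1 lamU (ltW ia0) wW
  wphi v01 d20 v0E d01.
exists a, L1, L2; split; last exact: le_trans de1.
exact: near_state_le nL _ _.
Qed.

End PoorApproximation.

Section Forward.
Context (R : realType) (K : ptopologicalType) (cK : compact [set: K]).
Context (hK : hausdorff_space K).
Local Notation CK := (contfun R cK).
Local Notation B := (borelType K).
Local Notation I := (@integral_functional R K cK).
Local Notation one := (contfun_cst cK 1).

(** Chebyshev's inequality on the set where h > 1 / 2. *)
Lemma tvnorm_separation (a b : probability B R) (h : CK) (e : R) :
  (forall x, 0 <= h x <= 1) -> 1 - e <= I b h -> I a h <= e ->
  2 - 8 * e <= tvnorm (charge_sub a b).
Proof.
move=> h01 be ae; have [P [mP -> Pmax]] := tvnorm_probability a b.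
pose A : set B := h @^-1` [set r | 1 / 2 < r].
have mA : measurable A.
  apply: open_measurable_borel; apply: open_comp; last exact: open_gt.
  by move=> x _; exact: contfun_continuous.
have aA : fine (a A) <= 2 * I a h.
  rewrite -(scalarZ (I a)); apply: integral_ge_measure => // x.
    by rewrite contfunZ; have := h01 x; lra.
  by rewrite contfunZ => Ax; have : 1 / 2 < h x by []; lra.
have bA : fine (b (~` A)) <= 2 * (1 - I b h).
  rewrite -[X in X - _](integral_probability_cst1 cK b) -(linearB (I b)) -(scalarZ (I b)).
  apply: integral_ge_measure; first exact: measurableC.
    by move=> x; rewrite contfunZ contfunB contfun_cst_val; have := h01 x; lra.
  move=> x /negP; rewrite -leNgt contfunZ contfunB contfun_cst_val => hx.
  by have : h x <= 1 / 2 by []; lra.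
have := Pmax _ (measurableC mA).
have c (p : probability B R) : fine (p (~` A)) = 1 - fine (p A).
  by rewrite probability_setC// fineB ?fin_num_measure.
by move: bA; rewrite !c; lra.
Qed.

Definition singularly_approximable (Z : closedSubspace CK) : Prop :=
  forall U : set K, open U ->
  forall pi1 pi2 : probability B R,
    is_probability_on U pi1 -> is_probability_on U pi2 ->
  forall eps : R, 0 < eps ->
  exists nu : probability B R,
    [/\ is_probability_on U nu, dual_norm Z (charge_sub nu pi1) < eps &
        tvnorm (charge_sub pi2 nu) > 2 - eps].

Lemma poor_singularly_approximable (Z : closedSubspace CK) :
  poor Z -> singularly_approximable Z.
Proof.
move=> poorZ U oU pi1 pi2 pi1U pi2U eps eps0.
have cut (p : probability B R) : is_probability_on U p ->
    forall d, 0 < d -> exists2 f, below U f & 1 - d <= I p f.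
  move=> pU d d0; have [f [f01 f0 fd]] := is_probability_on_cutoff cK hK oU pU d0.
  by exists f.
pose e := Num.min eps 1 / 100.
have m0 : 0 < Num.min eps 1 by rewrite lt_min ltr01 eps0.
have [m1 m2] : Num.min eps 1 <= eps /\ Num.min eps 1 <= 1.
  by split; rewrite ge_min lexx ?orbT.
have [e0 e1 ee] : [/\ 0 < e, e <= 1 / 100 & e <= eps / 100] by rewrite /e; split; lra.
clearbody e; clear m0 m1 m2.
have [a [L1 [L2 [nL ae]]]] := poor_near_state poorZ (integral_positive (cK := cK) pi2)
  (integral_probability_cst1 cK pi2) (integral_positive (cK := cK) pi1)
  (integral_probability_cst1 cK pi1) (cut _ pi2U) (cut _ pi1U) e0.
have [L1p L2p L12 L2e LZ [f [f01 fU] fL] [h [h01 _] [hL hpi2]]] := nL.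
have [mu [tmu muE]] := riesz_representation hK L1p.
have mU := open_measurable_borel oU.
have muT : fine (mu [set: B]) <= 1.
  rewrite -(integral_cst1 cK) -muE.
  have : 0 <= L2 one by apply: L2p => x; rewrite contfun_cst_val.
  by lra.
have muU : 1 - e <= fine (mu U).
  apply: (le_trans fL); rewrite muE; apply: integral_le_measure => //.
    by move=> x; case/andP: (f01 x).
  by move=> x /fU ->.
have muU1 : fine (mu U) <= 1 by apply: le_trans muT; exact: fine_measure_le.
have muU0 : 0 < fine (mu U) by lra.
have [nu [rho [nuU rhoE nurho]]] := normalized_restriction cK hK tmu oU muU0.
exists nu.
have rhoT : fine (rho [set: B]) <= e.
  have := fine_measureD mu measurableT mU.
  by rewrite setTI rhoE; lra.
have rho_norm g : `|I rho g| <= e * `|g|.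
  apply: (le_trans (positive_norm g (integral_positive (cK := cK) rho))).
  by rewrite /= integral_cst1 ler_wpM2r.
split => //.
- apply: (@le_lt_trans _ _ (5 * e)); last by lra.
  apply: dual_norm_le => z Zz z1.
  have := LZ z Zz; rewrite muE nurho => E.
  have h1 := rho_norm z; have h2 := positive_norm z L2p.
  have h3 := probability_integral_norm pi1 z.
  have h4 := probability_integral_norm nu z.
  have z0 : 0 <= `|z| by [].
  have h5 : e * `|z| <= e by rewrite -[leRHS]mulr1 ler_pM2l.
  have h6 : L2 one * `|z| <= e.
    apply: (@le_trans _ _ (e * `|z|)) => //; exact: ler_wpM2r.
  have h7 : `|(a - 1) * I pi1 z| <= e.
    rewrite normrM -[leRHS]mulr1; apply: ler_pM => //; exact: le_trans z1.
  have h8 : `|(1 - fine (mu U)) * I nu z| <= e.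
    rewrite normrM -[leRHS]mulr1; apply: ler_pM => //; last exact: le_trans z1.
    by rewrite ger0_norm ?subr_ge0// lerBlDr -lerBlDl.
  have -> : I nu z - I pi1 z = (1 - fine (mu U)) * I nu z + (a - 1) * I pi1 z
      + L2 z - I rho z.
    by move: E; set r := fine _; lra.
  move: h1 h2 h7 h8; rewrite !ler_norml; lra.
- apply: (@lt_le_trans _ _ (2 - 8 * (2 * e))); first by lra.
  apply: (tvnorm_separation h01); last by lra.
  have h_norm : `|h| <= 1.
    by apply: contfun_norm_le => // x; have /andP[? ?] := h01 x; rewrite ger0_norm.
  have := rho_norm h; rewrite ler_norml => /andP[_ rh].
  have : e * `|h| <= e by rewrite -[leRHS]mulr1 ler_pM2l.
  have nu0 : 0 <= I nu h by apply: integral_positive => x; case/andP: (h01 x).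
  have : fine (mu U) * I nu h <= I nu h by rewrite -[leRHS]mul1r ler_wpM2r.
  by move: hL; rewrite muE nurho; lra.
Qed.

End Forward.

(** * From singular approximation to the Daugavet property *)

(** A functional n of norm at most 1 that is 3 k-small on Z is a lower bound for
    quotient norms: n w <= `|v| + 3 k `|v - w| for every v in the class of w. A
    v of almost minimal norm has `|v - w| <= 5 + 8 c, whence the constants. *)
Lemma quotient_norm_test (R : realType) (V : normedModType R)
    (Z : closedSubspace V) (n e : {scalar V}) (f u : V) (c k : R) :
  0 < k < 1 / 4 -> 0 <= c -> (forall v, `|e v| <= c * `|v|) ->
  (forall v, `|n v| <= `|v|) -> (forall z, csub Z z -> `|n z| <= 3 * k * `|z|) ->
  `|f| <= 1 + k ^+ 2 -> `|u| <= 1 + k ->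
  1 - 8 * k <= n u -> 1 - 3 * k <= n f -> c - 7 * k <= e u ->
  1 + c - (31 + 30 * c) * k <= `|qproj Z (u + e u *: f)|.
Proof.
move=> /andP[k0 k4] c0 ec n_norm nZ fk uk nu nf eu.
set w := u + e u *: f.
have c1 : 0 <= c * k by rewrite mulr_ge0// ltW.
have eu_norm : `|e u| <= c + c * k.
  by apply: (le_trans (ec u)); rewrite -[X in X + _]mulr1 -mulrDr ler_wpM2l.
have k1 : k <= 1 by lra.
have kk : k ^+ 2 <= k by rewrite expr2 -[leRHS]mulr1 ler_pM2l.
have nw : 1 + c - (15 + 6 * c) * k <= n w.
  rewrite (linearD n)/= (scalarZ n).
  have nf1 : `|n f - 1| <= 3 * k.
    have := n_norm f; rewrite !ler_norml => /andP[_ nff].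
    by apply/andP; split; lra.
  have := ler_pM (normr_ge0 _) (normr_ge0 _) eu_norm nf1.
  rewrite -normrM ler_norml => /andP[+ _].
  have : c * k * k <= c * k by rewrite -[leRHS]mulr1 ler_wpM2l.
  lra.
have w_norm : `|w| <= 2 + 4 * c.
  apply: (le_trans (ler_normD _ _)); rewrite normrZ.
  have f2 : `|f| <= 2 by lra.
  have := ler_pM (normr_ge0 _) (normr_ge0 _) eu_norm f2.
  have : c * k <= c * 1 by rewrite ler_wpM2l.
  lra.
have [v vw vn] := norm_qproj_adherent (qproj Z w) k0.
have Zvw : csub Z (v - w) by apply/qprojP.
have qw := norm_qproj Z w.
have vw_norm : `|v - w| <= 5 + 8 * c.
  by apply: (le_trans (ler_normB _ _)); lra.
have k3 : 0 <= 3 * k by lra.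
have := le_trans (nZ _ Zvw) (ler_wpM2l k3 vw_norm).
have := n_norm v; rewrite (linearB n)/= !ler_norml => /andP[_ nv] /andP[nvw _].
lra.
Qed.

Section Backward.
Context (R : realType) (K : ptopologicalType) (cK : compact [set: K]).
Context (hK : hausdorff_space K).
Local Notation CK := (contfun R cK).
Local Notation B := (borelType K).
Local Notation I := (@integral_functional R K cK).
Local Notation one := (contfun_cst cK 1).
Context (Z : closedSubspace CK).

Hypothesis singular_approx : singularly_approximable Z.

(** The negative part of g - k lives on the null set outside U. *)
Lemma integral_ge_on (nu : probability B R) (U : set K) (g : CK) (k : R) :
  open U -> is_probability_on U nu -> (forall x, U x -> k <= g x) ->
  k <= I nu g.
Proof.
move=> oU [_ nuU] gU; have mU := open_measurable_borel oU.
pose p := contfun_max (contfun_cst cK k - g) 0.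
have pE x : p x = Num.max (k - g x) 0 by [].
have p0 x : 0 <= p x by rewrite pE le_max lexx orbT.
pose s := (`|p| + 1)^-1.
have s0 : 0 < s by rewrite invr_gt0 ltr_wpDl.
have : s * I nu p <= fine (nu (~` U)).
  rewrite -(scalarZ (I nu)); apply: integral_le_measure; first exact: measurableC.
    move=> x; rewrite contfunZ /s ler_pdivrMl ?ltr_wpDl// mulr1.
    by rewrite (le_trans (ler_norm _))// (le_trans (le_contfun_norm p x))// lerDl.
  move=> x /contrapT Ux; rewrite contfunZ pE max_r ?mulr0// subr_le0; exact: gU.
rewrite probability_setC// nuU subee// /= pmulr_rle0// => Ip.
have : I nu (contfun_cst cK k - g) <= I nu p.
  apply: positive_le; first exact: integral_positive.
  by move=> x; rewrite contfunB contfun_cst_val pE le_max lexx.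
rewrite (linearB (I nu))/= (functional_cst (I nu))/= integral_probability_cst1; lra.
Qed.

(** Replaces the restriction of lam to U by a functional nu with the same mass, which
    agrees with lam on Z up to d and the mass of lam outside U, and which a function
    h below U almost exhausts although h is almost invisible for m. The hypothesis is
    applied to the normalised restrictions of lam and m to U; regularity turns the
    separating Borel set into h. The domination of lam by m ensures that m U > 0 as
    soon as lam U > 0. *)
Lemma singular_bump (lam m : {finite_measure set B -> \bar R}) (U : set K) (d : R) :
  tight lam -> tight m -> (forall g : CK, (forall x, 0 <= g x) -> I lam g <= I m g) ->
  open U -> 0 < d ->
  exists (nu : {scalar CK}) (h : CK), [/\ positive nu, below U h,
    nu one = fine (lam U) &
    [/\ fine (lam U) - d <= nu h, I m h <= d,
     forall (g : CK) k, (forall x, U x -> k <= g x) -> k * fine (lam U) <= nu g &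
     forall z, csub Z z ->
       `|nu z - I lam z| <= (fine (lam (~` U)) + d) * `|z|]].
Proof.
move=> tlam tm lamm oU d0; have mU := open_measurable_borel oU.
have lamCU : fine (lam (~` U)) = fine (lam [set: B]) - fine (lam U).
  by rewrite (fine_measureD lam measurableT mU) setTI setTD; lra.
have [a0|a_le0] := ltP 0 (fine (lam U)); last first.
  have a0 : fine (lam U) = 0 by apply/eqP; rewrite eq_le a_le0 fine_ge0.
  have [nu nuE] := scalar_combination 0 0 (I lam) (I lam).
  have {}nuE g : nu g = 0 by rewrite nuE !mul0r addr0.
  exists nu, 0; rewrite a0; split => //.
  - by move=> g _; rewrite nuE.
  - exact: below0.
  split.
  - by rewrite nuE; lra.
  - by rewrite (linear0 (I m)) ltW.
  - by move=> g k _; rewrite nuE mulr0.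
  - move=> z _; rewrite nuE sub0r normrN lamCU a0 subr0.
    apply: (le_trans (positive_norm z (integral_positive (cK := cK) lam))).
    by rewrite /= integral_cst1 ler_wpM2r// lerDl ltW.
have b0 : 0 < fine (m U).
  have a2 : 0 < fine (lam U) / 2 by rewrite divr_gt0.
  have [F [cF FU lamF]] := regular_inner_closed hK (tight_regular cK hK tlam) mU a2.
  have [f [f01 f1 f0]] := urysohn_contfun R cK hK cF oU FU.
  have h1 : fine (lam F) <= I lam f.
    apply: integral_ge_measure; first exact: closed_measurable_borel.
      by move=> x; case/andP: (f01 x).
    by move=> x /f1 ->.
  have h2 : I lam f <= I m f by apply: lamm => x; case/andP: (f01 x).
  have h3 : I m f <= fine (m U).
    apply: integral_le_measure => //; first by move=> x; case/andP: (f01 x).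
    by move=> x /f0 ->.
  by lra.
have [pi1 [rho [pi1U rhoE lamE]]] := normalized_restriction cK hK tlam oU a0.
have [pi2 [sig [pi2U sigE mE]]] := normalized_restriction cK hK tm oU b0.
set a := fine (lam U) in a0 lamE *; set b := fine (m U) in b0 mE *.
have ab0 : 0 < a + b by lra.
pose ep := Num.min (d / (a + b)) 1.
have ep0 : 0 < ep by rewrite lt_min ltr01 divr_gt0.
have epd : ep * (a + b) <= d by rewrite -ler_pdivlMr// ge_min lexx.
have aep : 0 <= a * ep by rewrite mulr_ge0// ltW.
have bep : 0 <= b * ep by rewrite mulr_ge0// ltW.
have [nu [nuU nudual nutv]] := singular_approx oU pi1U pi2U ep0.
have [P [mP tvE _]] := tvnorm_probability pi2 nu.
rewrite tvE in nutv.
have mA : measurable ((U : set B) `\` P) by exact: measurableD.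
have le1 (p : probability B R) (A : set B) : measurable A -> fine (p A) <= 1.
  move=> mA'; rewrite -(integral_probability_cst1 cK p) integral_cst1.
  exact: fine_measure_le.
have ge0 (p : probability B R) (A : set B) : 0 <= fine (p A) by exact: fine_ge0.
have nuA : 1 - ep / 2 <= fine (nu (U `\` P)).
  have nuU1 : 1 = fine (nu (U `&` P)) + fine (nu ((U : set B) `\` P)).
    by rewrite -fine_measureD//; exact: (esym (congr1 fine nuU.2)).
  have : fine (nu (U `&` P)) <= fine (nu P).
    by apply: fine_measure_le => //; exact: measurableI.
  by have := le1 pi2 P mP; move: nuU1; lra.
have pi2A : fine (pi2 (U `\` P)) <= ep / 2.
  have : fine (pi2 (U `\` P)) <= fine (pi2 (~` P)).
    by apply: fine_measure_le => //; exact: measurableC.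
  rewrite probability_setC// fineB ?fin_num_measure//=.
  by have := ge0 nu P; lra.
have ep2 : 0 < ep / 2 by rewrite divr_gt0.
have [F [cF FA nuF]] := regular_inner_closed hK nuU.1 mA ep2.
have mF := closed_measurable_borel cF.
have [V [oV FV pi2V]] := regular_outer_open pi2U.1 mF ep2.
have mV := open_measurable_borel oV.
have pi2F : fine (pi2 F) <= ep / 2 by apply: le_trans pi2A; exact: fine_measure_le.
have FVU : F `<=` V `&` U by move=> x Fx; split; [exact: FV|case: (FA x Fx)].
have [h [h01 h1 h0]] := urysohn_contfun R cK hK cF (openI oV oU) FVU.
have hU : below U h.
  by split => // x nU; apply: h0 => -[].
have [nu' nu'E] := scalar_combination a 0 (I nu) (I nu).
have {}nu'E g : nu' g = a * I nu g by rewrite nu'E mul0r addr0.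
exists nu', h; split => //.
- move=> g g0; rewrite nu'E mulr_ge0 ?(ltW a0)//; exact: integral_positive.
- by rewrite nu'E integral_probability_cst1 mulr1.
split.
- have : fine (nu F) <= I nu h.
    apply: integral_ge_measure => //; first by move=> x; case/andP: (h01 x).
    by move=> x /h1 ->.
  move=> nuh; have : a * (1 - ep) <= a * I nu h by rewrite ler_pM2l//; lra.
  by rewrite nu'E; lra.
- rewrite mE.
  have : I sig h <= fine (sig U).
    apply: integral_le_measure => //; first by move=> x; case/andP: (h01 x).
    by move=> x nU; rewrite h0// => -[].
  rewrite sigE setDv measure0 /= => sigh.
  have : I pi2 h <= fine (pi2 V).
    apply: integral_le_measure => //; first by move=> x; case/andP: (h01 x).
    by move=> x nV; rewrite h0// => -[].
  move=> pi2h; have : b * I pi2 h <= b * ep by rewrite ler_pM2l//; lra.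
  lra.
- move=> g k gU; rewrite nu'E mulrC ler_pM2l//; exact: integral_ge_on gU.
- move=> z Zz; rewrite nu'E lamE.
  have -> : a * I nu z - (a * I pi1 z + I rho z) =
    a * (I nu z - I pi1 z) - I rho z by ring.
  apply: (le_trans (ler_normB _ _)); rewrite [X in _ <= X]mulrDl addrC lerD//.
    apply: (le_trans (positive_norm z (integral_positive (cK := cK) rho))).
    by rewrite /= integral_cst1 rhoE setTD.
  rewrite normrM gtr0_norm//.
  have := le_dual_norm nu pi1 Zz => h2.
  have : a * `|I nu z - I pi1 z| <= a * (ep * `|z|).
    rewrite ler_pM2l//; apply: (le_trans h2); rewrite ler_wpM2r//; exact: ltW.
  have : (a * ep) * `|z| <= d * `|z| by rewrite ler_wpM2r//; lra.
  lra.
Qed.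

(** Markov's inequality for k - f, which is at least t outside U. *)
Lemma concentration (lam : {finite_measure set B -> \bar R}) (U : set K)
    (f : CK) (k t : R) : open U -> 0 < t -> (forall x, f x <= k) ->
  (forall x, ~ U x -> f x <= k - t) ->
  t * fine (lam (~` U)) <= k * fine (lam [set: B]) - I lam f.
Proof.
move=> oU t0 fk fU; have mCU := measurableC (open_measurable_borel oU).
rewrite mulrC -ler_pdivlMr// mulrC.
have -> : t^-1 * (k * fine (lam [set: B]) - I lam f) =
    I lam (t^-1 *: (contfun_cst cK k - f)).
  rewrite (scalarZ (I lam)) (linearB (I lam))/= (functional_cst (I lam))/=.
  by rewrite integral_cst1.
apply: integral_ge_measure => // x; rewrite contfunZ contfunB contfun_cst_val.
  by rewrite mulr_ge0 ?invr_ge0 ?(ltW t0)// subr_ge0.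
by move=> /fU fx; rewrite ler_pdivlMl// mulr1; lra.
Qed.

Lemma pair_arith (a b n1u n2u n1f n2f k : R) :
  a - 3 * k <= n1u -> b - 3 * k <= - n2u ->
  (1 - k) * a <= n1f -> (1 - k) * b <= - n2f ->
  1 - 2 * k <= a + b <= 1 -> 0 < k -> k < 1 / 4 ->
  1 - 8 * k <= n1u - n2u /\ 1 - 3 * k <= n1f - n2f.
Proof.
move=> ? ? ? ? /andP[ab _] k0 k4.
have : (1 - k) * (1 - 2 * k) <= (1 - k) * (a + b) by rewrite ler_wpM2l//; lra.
have : 0 <= k * k by rewrite mulr_ge0// ltW.
by split; lra.
Qed.

(** Splits a norming functional of the class of f into its positive parts. As
    `|f| <= 1 + k ^ 2 and y f = 1, the parts leave mass at most k outside
    {f > 1 - k} and {f < -(1 - k)}, because each unit of mass there loses at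
    least k + k ^ 2. singular_bump is then applied on these sets, which are
    disjoint; this is why h1 and h2 never overlap. *)
Lemma concentrated_pair (f : CK) (k : R) (M0 : {scalar CK}) : positive M0 ->
  0 < k < 1 -> `|qproj Z f| = 1 -> `|f| <= 1 + k ^+ 2 ->
  exists (n1 n2 : {scalar CK}) (h1 h2 : CK),
  [/\ positive n1 /\ positive n2, below [set: K] h1 /\ below [set: K] h2,
      forall x, h1 x = 0 \/ h2 x = 0,
      1 - 2 * k <= n1 one + n2 one <= 1 &
   [/\ n1 one - k <= n1 h1, n2 one - k <= n2 h2, M0 h1 <= k /\ M0 h2 <= k,
      (1 - k) * n1 one <= n1 f /\ (1 - k) * n2 one <= n2 (- f) &
      forall z, csub Z z -> `|n1 z - n2 z| <= 3 * k * `|z| ]].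
Proof.
move=> M0p /andP[k0 k1] f1 fk.
have [y [y1 yZ yf]] := norming_annihilator Z f; rewrite f1 in yf.
have y1' v : y v <= 1 * `|v| by rewrite mul1r (le_trans (ler_norm _)).
have [L1 [L2 [L1p L2p L12 yE]]] := jordan_functional ler01 y1'.
have [lam1 [tlam1 L1E]] := riesz_representation hK L1p.
have [lam2 [tlam2 L2E]] := riesz_representation hK L2p.
(* M dominates L1 and L2 as well as M0, as singular_bump requires *)
have [N NE] := scalar_combination 1 1 L1 L2.
have [M ME] := scalar_combination 1 1 M0 N.
have {NE}ME g : M g = M0 g + L1 g + L2 g by rewrite ME NE !mul1r addrA.
have Mp : positive M.
  by move=> g g0; rewrite ME !addr_ge0//; [exact: M0p|exact: L1p|exact: L2p].
have [m [tm mE]] := riesz_representation hK Mp.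
have lam1m (g : CK) : (forall x, 0 <= g x) -> I lam1 g <= I m g.
  move=> g0; rewrite -L1E -mE ME addrAC lerDr addr_ge0//; [exact: M0p|exact: L2p].
have lam2m (g : CK) : (forall x, 0 <= g x) -> I lam2 g <= I m g.
  move=> g0; rewrite -L2E -mE ME lerDr addr_ge0//; [exact: M0p|exact: L1p].
have M0m (g : CK) : (forall x, 0 <= g x) -> M0 g <= I m g.
  move=> g0; rewrite -mE ME -addrA lerDl addr_ge0//; [exact: L1p|exact: L2p].
pose U1 := f @^-1` [set r | 1 - k < r].
pose U2 := f @^-1` [set r | r < - (1 - k)].
have oU1 : open U1.
  apply: open_comp; last exact: open_gt.
  by move=> x _; exact: contfun_continuous.
have oU2 : open U2.
  apply: open_comp; last exact: open_lt.
  by move=> x _; exact: contfun_continuous.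
have U12 x : U1 x -> U2 x -> False.
  rewrite /U1 /U2 /= => h1 h2; have := lt_trans h1 h2; clear -k1 hK singular_approx; lra.
have k20 : 0 <= k ^+ 2 by rewrite sqr_ge0.
have t0 : 0 < k + k ^+ 2 by rewrite ltr_pwDl.
have fx x : - (1 + k ^+ 2) <= f x <= 1 + k ^+ 2.
  by rewrite -ler_norml (le_trans (le_contfun_norm f x)).
have kkE : 1 + k ^+ 2 - (k + k ^+ 2) = 1 - k by ring.
have lam1C : (k + k ^+ 2) * fine (lam1 (~` U1)) <=
    (1 + k ^+ 2) * fine (lam1 [set: B]) - I lam1 f.
  apply: concentration => // x; first by case/andP: (fx x).
  by move=> /negP; rewrite -leNgt kkE.
have lam2C : (k + k ^+ 2) * fine (lam2 (~` U2)) <=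
    (1 + k ^+ 2) * fine (lam2 [set: B]) - I lam2 (- f).
  apply: concentration => // x; rewrite contfunN.
    by rewrite lerNl; case/andP: (fx x).
  by move=> /negP; rewrite -leNgt kkE lerNl.
have CE (lam : {finite_measure set B -> \bar R}) (L : {scalar CK}) U : open U ->
    (forall g, L g = I lam g) -> fine (lam U) = L one - fine (lam (~` U)).
  move=> oU LE; rewrite LE integral_cst1.
  rewrite (fine_measureD lam measurableT (open_measurable_borel oU)).
  by rewrite setTI setTD addrK.
have lam1T : fine (lam1 [set: B]) = L1 one by rewrite L1E integral_cst1.
have lam2T : fine (lam2 [set: B]) = L2 one by rewrite L2E integral_cst1.
rewrite lam1T -L1E in lam1C; rewrite lam2T -L2E (linearN L2)/= in lam2C.
have [n1 [h1 [n1p [h101 h1U] n1one [n1h mh1 n1g n1z]]]] :=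
  singular_bump tlam1 tm lam1m oU1 k0.
have [n2 [h2 [n2p [h201 h2U] n2one [n2h mh2 n2g n2z]]]] :=
  singular_bump tlam2 tm lam2m oU2 k0.
have aE := CE _ _ _ oU1 L1E; have bE := CE _ _ _ oU2 L2E.
rewrite -n1one in aE n1h n1g; rewrite -n2one in bE n2h n2g.
have p10 : 0 <= fine (lam1 (~` U1)) by exact: fine_ge0.
have p20 : 0 <= fine (lam2 (~` U2)) by exact: fine_ge0.
have L12f : L1 f - L2 f = 1 by rewrite -yE.
have LZ z : csub Z z -> I lam1 z = I lam2 z.
  by move=> /yZ; rewrite yE L1E L2E => /subr0_eq.
have [p12 ab] : fine (lam1 (~` U1)) + fine (lam2 (~` U2)) <= k /\
    1 - 2 * k <= n1 one + n2 one <= 1.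
  move: lam1C lam2C p10 p20 L12f aE bE L12 k0 t0 k20; clear -k1 hK singular_approx.
  move: (fine (lam1 _)) (fine (lam2 _)) (L1 f) (L2 f) (L1 one) (L2 one).
  move: (n1 one) (n2 one) => a b p q x1 x2 l1 l2 c1 c2 p0 q0 xE aE bE l12 k0 t0 k20.
  have s12 : (1 + k ^+ 2) * (l1 + l2) <= 1 + k ^+ 2.
    by rewrite -[leRHS]mulr1 ler_pM2l// ltr_pwDl.
  have h : (k + k ^+ 2) * (p + q) <= k ^+ 2 by rewrite mulrDr; lra.
  have pq : p + q <= k.
    rewrite -(ler_pM2l k0) -expr2; apply: le_trans h.
    by rewrite mulrDl lerDl mulr_ge0// addr_ge0.
  split => //.
  have h1 : 0 <= (k + k ^+ 2) * p by rewrite mulr_ge0// ltW.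
  have h2 : 0 <= (k + k ^+ 2) * q by rewrite mulr_ge0// ltW.
  have h3 : k ^+ 2 * (l1 + l2) <= k ^+ 2 by rewrite -[leRHS]mulr1 ler_wpM2l.
  have h4 : k ^+ 2 <= k by rewrite expr2 -[leRHS]mulr1 ler_pM2l// ltW.
  by apply/andP; split; lra.
exists n1, n2, h1, h2; split => //.
- by split; split=> // x /(_ Logic.I).
- by move=> x; have [Ux|nU] := pselect (U1 x);
    [right; apply: h2U; exact: U12|left; exact: h1U].
split => //.
- split; [apply: le_trans mh1|apply: le_trans mh2]; apply: M0m => x.
    by case/andP: (h101 x).
  by case/andP: (h201 x).
- split; first by apply: n1g => x /ltW.
  by apply: n2g => x; rewrite contfunN lerNr => /ltW.
- move=> z Zz; have -> : n1 z - n2 z = (n1 z - I lam1 z) - (n2 z - I lam2 z).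
    by rewrite (LZ z Zz) opprB addrA subrK.
  apply: (le_trans (ler_normB _ _)); apply: (le_trans (lerD (n1z z Zz) (n2z z Zz))).
  rewrite -mulrDl ler_wpM2r// addrACA.
  have -> : 3 * k = k + (k + k) by ring.
  by rewrite lerD2r.
Qed.

Lemma bump_value (s p q k : R) : 0 < k < 1 -> - (1 + k) <= s <= 1 + k ->
  0 <= p <= 1 -> 0 <= q <= 1 -> p = 0 \/ q = 0 ->
  let r := s * (1 - (p + q)) + (p - q) in
  [/\ - (1 + k) + (2 + k) * p <= r, - (1 + k) + (2 + k) * q <= - r,
      `|r| <= 1 + k & `|r - s| <= 3 * (p + q)].
Proof.
move=> /andP[k0 k1] s12 p01 q01 pq0.
have conv x : 0 <= x <= 1 -> [/\ - (1 + k) * (1 - x) <= s * (1 - x),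
    s * (1 - x) <= (1 + k) * (1 - x), - (2 * x) <= s * x <= 2 * x &
    0 <= k * x <= x].
  move: s12 => /andP[s1 s2] /andP[x0 x1]; split.
  - by rewrite ler_wpM2r// subr_ge0.
  - by rewrite ler_wpM2r// subr_ge0.
  - rewrite -mulNr !ler_wpM2r//; lra.
  - apply/andP; split; first exact: mulr_ge0 (ltW k0) x0.
    by rewrite ler_piMl// ltW.
have [A1 A2 A3 A4] := conv p p01; have [B1 B2 B3 B4] := conv q q01.
by case: pq0 => -> /= in A1 A2 A3 A4 B1 B2 B3 B4 *; rewrite !ler_norml; split; lra.
Qed.

(** Where h is close to 1 so is u, and n is almost carried by that set. *)
Lemma bump_functional (n : {scalar CK}) (h u : CK) (k : R) : positive n ->
  0 < k < 1 -> (forall x, - (1 + k) + (2 + k) * h x <= u x) ->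
  n one - k <= n h -> n one - 3 * k <= n u.
Proof.
move=> np /andP[k0 k1] hu nh.
have : n ((2 + k) *: h - (1 + k) *: one) <= n u.
  apply: positive_le => // x; rewrite contfunB !contfunZ contfun_cst_val.
  by have := hu x; lra.
rewrite (linearB n)/= !(scalarZ n).
have : (2 + k) * (n one - k) <= (2 + k) * n h by rewrite ler_wpM2l// addr_ge0// ltW.
have : k * k <= k * 1 by rewrite ler_pM2l// ltW.
lra.
Qed.

(** Changing the argument only where h lives hardly affects a functional
    M1 - M2 whose positive parts are small at h. *)
Lemma bump_perturbation (M1 M2 : {scalar CK}) (d h : CK) (k : R) :
  positive M1 -> positive M2 -> (forall x, `|d x| <= 3 * h x) ->
  M1 h + M2 h <= k -> - (3 * k) <= M1 d - M2 d.
Proof.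
move=> M1p M2p dh Mh.
have m1 : - (3 * M1 h) <= M1 d.
  rewrite -(scalarZ M1) -(linearN M1); apply: positive_le => // x.
  by rewrite contfunN contfunZ; have := dh x; rewrite ler_norml => /andP[].
have m2 : M2 d <= 3 * M2 h.
  rewrite -(scalarZ M2); apply: positive_le => // x.
  by rewrite contfunZ; have := dh x; rewrite ler_norml => /andP[].
lra.
Qed.

(** u is u0, which almost norms e, overwritten by 1 through h1 and by -1
    through h2. Neither bump is seen by e, and together they determine the value
    of n1 - n2 at u. *)
Lemma daugavet_estimate (e : {scalar CK}) (f u0 : CK) (c k : R) :
  0 < k < 1 / 4 -> 0 <= c -> (forall v, `|e v| <= c * `|v|) ->
  `|qproj Z f| = 1 -> `|f| <= 1 + k ^+ 2 ->
  `|u0| <= 1 + k -> c - k <= e u0 ->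
  exists u, `|u| <= 1 + k /\
    1 + c - (31 + 30 * c) * k <= `|qproj Z (u + e u *: f)|.
Proof.
move=> /[dup] k14 /andP[k0 k4] c0 ec f1 fk u0k eu0.
have k01 : 0 < k < 1 by apply/andP; split => //; lra.
have ec' v : e v <= c * `|v| by rewrite (le_trans (ler_norm _)).
have [M1 [M2 [M1p M2p _ eE]]] := jordan_functional c0 ec'.
have [M ME] := scalar_combination 1 1 M1 M2.
have {}ME g : M g = M1 g + M2 g by rewrite ME !mul1r.
have Mp : positive M.
  by move=> g g0; rewrite ME addr_ge0//; [exact: M1p|exact: M2p].
have [n1 [n2 [h1 [h2 [[n1p n2p] [[h101 _] [h201 _]] h12 ab P]]]]] :=
  concentrated_pair Mp k01 f1 fk.
have [n1h n2h [Mh1 Mh2] [n1f n2f] nZ] := P.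
have [n nE] := scalar_combination 1 (- 1) n1 n2.
have {}nE v : n v = n1 v - n2 v by rewrite nE mul1r mulN1r.
have n_norm v : `|n v| <= `|v|.
  rewrite nE (le_trans (ler_normB _ _))//.
  apply: (le_trans (lerD (positive_norm v n1p) (positive_norm v n2p))).
  by rewrite -mulrDl -[leRHS]mul1r ler_wpM2r//; case/andP: ab.
have [u uE] : exists u : CK, forall x,
    u x = u0 x * (1 - (h1 x + h2 x)) + (h1 x - h2 x).
  by exists (contfun_mul u0 (one - (h1 + h2)) + (h1 - h2)).
have u0x x : - (1 + k) <= u0 x <= 1 + k.
  by rewrite -ler_norml (le_trans (le_contfun_norm u0 x)).
have ux x := bump_value k01 (u0x x) (h101 x) (h201 x) (h12 x).
have uk : `|u| <= 1 + k.
  apply: contfun_norm_le => [|x]; first by rewrite addr_ge0// ltW.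
  by rewrite uE; case: (ux x).
have n1u : n1 one - 3 * k <= n1 u.
  by apply: bump_functional n1h => // x; rewrite uE; case: (ux x).
have n2u : n2 one - 3 * k <= n2 (- u).
  by apply: bump_functional n2h => // x; rewrite contfunN uE; case: (ux x).
have eu : c - 7 * k <= e u.
  have -> : e u = e u0 + (M1 (u - u0) - M2 (u - u0)).
    by rewrite -eE (linearB e)/= addrC subrK.
  have -> : c - 7 * k = (c - k) - 3 * (2 * k) by ring.
  apply: lerD => //; apply: (bump_perturbation (h := h1 + h2)) => // [x|].
    by rewrite contfunB contfunD uE; case: (ux x).
  by rewrite -ME (linearD M)/= mulr_natl mulr2n lerD.
rewrite (linearN n2)/= in n2u; rewrite (linearN n2)/= in n2f.
have [nu nf] : 1 - 8 * k <= n u /\ 1 - 3 * k <= n f.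
  by rewrite !nE; exact: (pair_arith n1u n2u n1f n2f ab k0 k4).
exists u; split => //.
by apply: (quotient_norm_test (n := n)) => // z Zz; rewrite nE nZ.
Qed.

End Backward.

Lemma le0_of_small (R : realType) (x C : R) :
  (forall k, 0 < k < 1 / 4 -> x <= C * k) -> x <= 0.
Proof.
move=> h; rewrite leNgt; apply/negP => x0.
have C1 : 0 < `|C| + 1 by rewrite ltr_wpDl.
pose k := Num.min (1 / 8) (x / (2 * (`|C| + 1))).
have k0 : 0 < k by rewrite lt_min !divr_gt0// mulr_gt0.
have k1 : k <= 1 / 8 by rewrite ge_min lexx.
have k2 : k * (2 * (`|C| + 1)) <= x.
  by rewrite -ler_pdivlMr ?mulr_gt0// ge_min lexx orbT.
have /h : 0 < k < 1 / 4 by rewrite k0; lra.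
have : C * k <= `|C| * k by rewrite ler_wpM2r ?ler_norm// ltW.
lra.
Qed.

(** Only the lower bound of the norm of Id + T is at stake, for T of the form
    x |-> phi x q with q of norm 1, and approximately normed vectors x suffice
    since the error is linear in k. *)
Lemma daugavet_of_approx (R : realType) (Y : normedModType R) :
  (forall (T : {linear Y -> Y}) (q : Y) (c : R), `|q| = 1 -> 
     (forall x, `|T x| <= c * `|x|) -> (forall x, exists a, T x = a *: q) ->
     (forall d, 0 < d -> exists2 x, `|x| <= 1 & c - d < `|T x|) ->
     exists C : R, forall k, 0 < k < 1 / 4 -> exists x, 
       `|x| <= 1 + k /\ 1 + c - C * k <= `|x + T x|) ->
  daugavet Y.
Proof.
move=> approx T bT [y0 y00 rT].
have /pinfty_ex_gt0[C C0 TC] := (linear_boundedP T).1 bT.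
set c := opnorm T.
have Tset : has_sup [set `|T x| | x in [set x : Y | `|x| <= 1]].
  split; first by exists `|T 0|, 0 => //=; rewrite normr0 ler01.
  exists C => _ [x /= x1 <-]; apply: (le_trans (TC x)).
  by rewrite -[leRHS]mulr1 ler_wpM2l// ltW.
have Tc1 x : `|x| <= 1 -> `|T x| <= c.
  by move=> x1; apply: ub_le_sup; [exact: Tset.2|exists x].
have Tc x : `|T x| <= c * `|x|.
  have [->|x0] := eqVneq x 0; first by rewrite linear0 !normr0 mulr0.
  have n0 : 0 < `|x| by rewrite normr_gt0.
  rewrite -ler_pdivrMr// -[`|x|^-1]gtr0_norm ?invr_gt0// mulrC -normrZ.
  rewrite -linearZ; apply: Tc1.
  by rewrite normrZ gtr0_norm ?invr_gt0// mulVf// gt_eqF.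
have Idset x : `|x| <= 1 -> `|x + T x| <= 1 + c.
  by move=> x1; rewrite (le_trans (ler_normD _ _))// lerD// Tc1.
pose S := opnorm (fun x => x + T x).
have Sne : [set `|x + T x| | x in [set x : Y | `|x| <= 1]] !=set0.
  by exists `|0 + T 0|, 0 => //=; rewrite normr0 ler01.
have leS x : `|x| <= 1 -> `|x + T x| <= S.
  move=> x1; apply: ub_le_sup; last by exists x.
  by exists (1 + c) => _ [y /= y1 <-]; exact: Idset.
apply/eqP; rewrite eq_le; apply/andP; split.
  by apply: ge_sup => // _ [x /= x1 <-]; exact: Idset.
have n0 : 0 < `|y0| by rewrite normr_gt0.
have q1 : `| `|y0|^-1 *: y0| = 1.
  by rewrite normrZ gtr0_norm ?invr_gt0// mulVf// gt_eqF.
have [|d d0|D DP] := approx T _ c q1 Tc.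
- move=> x; have : range T (T x) by exists x.
  rewrite rT => -[a _ <-]; exists (a * `|y0|).
  by rewrite scalerA mulfK// gt_eqF.
- have [_ [x x1 <-] ?] := sup_adherent d0 Tset; by exists x.
rewrite -subr_le0; apply: (@le0_of_small _ _ (S + D)) => k /[dup] k01 /andP[k0 _].
have [x [xk xT]] := DP k k01.
have k1 : 0 < 1 + k by rewrite ltr_pwDl// ltW.
have : `|x + T x| <= S * (1 + k).
  rewrite -ler_pdivrMr// mulrC -[(1 + k)^-1]gtr0_norm ?invr_gt0// -normrZ.
  rewrite scalerDr -linearZ; apply: leS.
  by rewrite normrZ gtr0_norm ?invr_gt0// ler_pdivrMl// mulr1.
rewrite -/S -/c; lra.
Qed.

Section Conclusion.
Context (R : realType) (K : ptopologicalType) (cK : compact [set: K]).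
Context (hK : hausdorff_space K).
Local Notation CK := (contfun R cK).

Lemma singularly_approximable_daugavet (Z : closedSubspace CK) :
  singularly_approximable Z -> daugavet (quotient Z).
Proof.
move=> singular; apply: daugavet_of_approx => T q c q1 Tc Tline Tadh.
have [phi phiE] := choice Tline.
have q0 : q != 0 by rewrite -normr_gt0 q1.
have phi_inj a b : a *: q = b *: q -> a = b.
  move=> /eqP; rewrite -subr_eq0 -scalerBl scaler_eq0 (negbTE q0) orbF.
  by rewrite subr_eq0 => /eqP.
have phi_norm x : `|phi x| = `|T x| by rewrite phiE normrZ q1 mulr1.
pose e0 : CK -> R^o := fun v => phi (qproj Z v).
have e0lin : linear_for *%R e0.
  move=> a u v; apply: phi_inj; rewrite /e0 -phiE -qproj_add -qproj_scale linearP.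
  by rewrite !phiE scalerDl scalerA.
pose e : {scalar CK} := HB.pack e0 (GRing.isLinear.Build R CK R^o *%R e0 e0lin).
have eE v : T (qproj Z v) = e v *: q by rewrite phiE.
have c0 : 0 <= c by have := Tc q; rewrite q1 mulr1; exact: le_trans.
have ec v : `|e v| <= c * `|v|.
  rewrite -[`|e v|]mulr1 -q1 -normrZ -eE (le_trans (Tc _))// ler_wpM2l//.
  exact: norm_qproj.
exists (31 + 30 * c) => k /[dup] k01 /andP[k0 _].
have [f fq fk] := norm_qproj_adherent q (exprn_gt0 2 k0).
have [x x1 xT] := Tadh _ k0.
have [v vx vk] := norm_qproj_adherent x k0.
have vk1 : `|v| <= 1 + k by rewrite (le_trans (ltW vk))// lerD2r.
have ev : c - k <= `|e v|.
  by rewrite -[`|e v|]mulr1 -q1 -normrZ -eE vx ltW.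
have [u0 u0k u0e] : exists2 u0 : CK, `|u0| <= 1 + k & c - k <= e u0.
  have [ev0|ev0] := leP 0 (e v); first by exists v => //; rewrite -(ger0_norm ev0).
  by exists (- v); rewrite ?normrN// linearN -(ltr0_norm ev0).
rewrite q1 in fk.
have f1 : `|qproj Z f| = 1 by rewrite fq.
have [u [uk ue]] := daugavet_estimate hK singular k01 c0 ec f1 (ltW fk) u0k u0e.
exists (qproj Z u); split; first exact: le_trans (norm_qproj Z u) uk.
by rewrite eE -fq qproj_scale qproj_add.
Qed.

Lemma singularly_approximable_poor (Z : closedSubspace CK) :
  singularly_approximable Z -> poor Z.
Proof.
move=> singular Z' Z'Z; apply: singularly_approximable_daugavet.
move=> U oU pi1 pi2 pi1U pi2U eps eps0.
have [nu [nuU nuZ nutv]] := singular U oU pi1 pi2 pi1U pi2U eps eps0.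
exists nu; split => //; apply: le_lt_trans nuZ; apply: dual_norm_le => z Z'z z1.
exact: (le_dual_norm1 nu pi1 (Z'Z _ Z'z) z1).
Qed.

End Conclusion.

Unset Implicit Arguments.
Set Strict Implicit.

(** * The characterisation of poor subspaces *)

Theorem corollary6p3 (R : realType) (K : ptopologicalType)
    (cK : compact [set: K]) (hK : hausdorff_space K)
    (pK : perfect_set [set: K]) (Z : closedSubspace (contfun R cK)) :
  poor Z <->
  (forall U : set K, open U ->
   forall pi1 pi2 : probability (borelType K) R,
     is_probability_on U pi1 -> is_probability_on U pi2 ->
   forall eps : R, 0 < eps ->
   exists nu : probability (borelType K) R,
     [/\ is_probability_on U nu,
         dual_norm Z (charge_sub nu pi1) < eps &
         tvnorm (charge_sub pi2 nu) > 2 - eps]).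
Proof.
split; first exact: poor_singularly_approximable.
exact: singularly_approximable_poor.
Qed.
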